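(* Let $G$ be a loopless multigraph on $[n]$ and let $F_1,\ldots,F_l$ be the full dimensional leaves of $R_G^{\mathcal{O}}$ in depth-first search order. For each $i$ let $$P_i=\{\{Q^i_1,\ldots,Q^i_{f(i)}\}\}=\{\{F_i\cap F_j : 1\le j<i,\ |E(F_i\cap F_j)|=|E(F_i)|-1\}\}$$ (a multiset). Then $$\sum_{i=1}^l\prod_{j=1}^{f(i)}(F_i+Q^i_j)$$ is the formal sum of the set of leaves of $R_G^{\mathcal{O}}$, where the product of graphs means their intersection, and where for $f(i)=0$ the product $\prod_{j=1}^{f(i)}(F_i+Q^i_j)$ is defined to be $F_i$. Equivalently, the multiset consisting of the graphs $F_i$ together with $\bigcap_{Q\in S}Q$ for all $i$ and all nonempty sub-multisets $S$ of $P_i$ equals the multiset of all leaves of $R_G^{\mathcal{O}}$.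
   Context: Graphs are finite loopless multigraphs on $[n]$, edges $(i,j)$ with $i<j$. Reduction on edges $a=(i,j)$, $b=(j,k)$, $i<j<k$, of a graph $H$ produces $H_1$ ($E(H)\setminus\{b\}\cup\{(i,k)\}$), $H_2$ ($E(H)\setminus\{a\}\cup\{(i,k)\}$), $H_3$ ($E(H)\setminus\{a,b\}\cup\{(i,k)\}$), the new edge $(i,k)$ being formally $a+b$. A reduction tree of $G$ is a rooted tree of graphs with root $G$, each non-leaf node $H$ having three children from one reduction, ordered left $H_1$, middle $H_3$, right $H_2$; leaves are the graphs with no pair $(i,j),(j,k)$, $i<j<k$. Every edge of a node is a formal sum of edges of $G$ (edges of $G$ distinguished); edges of different graphs are equal iff they are sums of the same edges of $G$. The intersection $H\cap H'$ of two such graphs is the graph on $[n]$ whose edges are the edges common to both in this sense. A leaf is full dimensional if it has $|E(G)|$ edges. Depth-first search order lists leaves of the left subtree, then the middle, then the right, recursively. Order $\mathcal{O}$: at a non-leaf node, take the smallest vertex $v$ having edges $(a,v)$, $a<v$, and $(v,b)$, $b>v$, and reduce on such edges with $a$ minimal and $b$ maximal; the result is $R_G^{\mathcal{O}}$.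
   Formalization: The order O does not say which of several parallel edges (a,v) or (v,b) is reduced, and free choices make the claim false; ties are broken by fixed total orders on formal sums of edges of G compatible with addition, one for incoming and one for outgoing edges. *)

(* Defs.v *)
From HB Require Import structures.
From mathcomp Require Import all_boot all_order all_algebra finmap.

Set Implicit Arguments.
Unset Strict Implicit.
Unset Printing Implicit Defensive.

Import GRing.Theory.
Local Open Scope fset_scope.

(* The vertex set [n] is 'I_n; edges are distinguished, each being oriented
   from its smaller to its larger end. *)
Record multigraph (n : nat) := MultiGraph {
  edge : finType;
  src : edge -> 'I_n;
  tgt : edge -> 'I_n;
  src_lt_tgt : forall e : edge, (src e < tgt e)%N
}.

Section Defs.
Variables (n : nat) (G : multigraph n).

(* Formal sums of edges of G, as coefficient functions. *)
Definition fsum := {ffun edge G -> nat}.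

Definition fsum1 (e : edge G) : fsum := [ffun e' => (e' == e) : nat].

(* An edge of a node of a reduction tree is (i, j, x): its ends and the formal
   sum x it stands for.  In a reduction tree of G the edges of G occurring in x
   form a path from i to j, so x determines i and j, and equality of triples is
   equality of formal sums. *)
Definition nedge := ('I_n * 'I_n * fsum)%type.

Definition nsrc (a : nedge) : 'I_n := a.1.1.
Definition ntgt (a : nedge) : 'I_n := a.1.2.
Definition nsum (a : nedge) : fsum := a.2.

(* Distinct edges of a node have distinct formal sums, so the edges of a node
   form a set even when some of them are parallel; E(H) is H itself, and the
   intersection of graphs is `&`. *)
Definition ngraph := {fset nedge}.

Definition root_graph : ngraph :=
  [fset ((src e, tgt e, fsum1 e) : nedge) | e in edge G].

Definition composable (a b : nedge) : bool :=
  [&& (nsrc a < ntgt a)%N, ntgt a == nsrc b & (nsrc b < ntgt b)%N].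

Definition join_edge (a b : nedge) : nedge := (nsrc a, ntgt b, (nsum a + nsum b)%R).

Definition red1 (H : ngraph) (a b : nedge) : ngraph :=
  (H `\ b) `|` [fset join_edge a b].
Definition red2 (H : ngraph) (a b : nedge) : ngraph :=
  (H `\ a) `|` [fset join_edge a b].
Definition red3 (H : ngraph) (a b : nedge) : ngraph :=
  (H `\ a `\ b) `|` [fset join_edge a b].

Definition irreducible_graph (H : ngraph) : Prop :=
  forall a b : nedge, a \in H -> b \in H -> ~~ composable a b.

Inductive tree : Type :=
| Leaf of ngraph
| Node of ngraph & tree & tree & tree.

(* [sel H a b] is the rule saying that H may be reduced on a and b. *)
Inductive reduction_tree (sel : ngraph -> nedge -> nedge -> Prop) :
    ngraph -> tree -> Prop :=
| RTLeaf H : irreducible_graph H -> reduction_tree sel H (Leaf H)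
| RTNode H a b T1 T3 T2 :
    a \in H -> b \in H -> composable a b -> sel H a b ->
    reduction_tree sel (red1 H a b) T1 ->
    reduction_tree sel (red3 H a b) T3 ->
    reduction_tree sel (red2 H a b) T2 ->
    reduction_tree sel H (Node H T1 T3 T2).

(* The order O fixes the ends of the two edges to be reduced, but not the
   choice among parallel edges.  That choice cannot be left free at each node
   (intersections of leaves would then depend on unrelated choices made in
   different subtrees); it is made by a total order, fixed for the whole tree
   and compatible with the addition of formal sums, such as the lexicographic
   order attached to a numbering of the edges of G. *)
Definition tie_order (le : rel fsum) : Prop :=
  [/\ total le, antisymmetric le, transitive le
    & forall x y z : fsum, le x y -> le (x + z)%R (y + z)%R].

Definition order_O (le_in le_out : rel fsum)
    (H : ngraph) (a b : nedge) : Prop :=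
  [/\ forall a' b' : nedge, a' \in H -> b' \in H -> composable a' b' ->
        (ntgt a <= ntgt a')%N,
      forall a' : nedge, a' \in H -> composable a' b ->
        (nsrc a < nsrc a')%N \/ nsrc a = nsrc a' /\ le_in (nsum a) (nsum a')
    & forall b' : nedge, b' \in H -> composable a b' ->
        (ntgt b' < ntgt b)%N \/ ntgt b' = ntgt b /\ le_out (nsum b') (nsum b)].

Definition is_R_O (le_in le_out : rel fsum) (T : tree) : Prop :=
  reduction_tree (order_O le_in le_out) root_graph T.

Fixpoint leaves (T : tree) : seq ngraph :=
  match T with
  | Leaf H => [:: H]
  | Node _ T1 T3 T2 => leaves T1 ++ leaves T3 ++ leaves T2
  end.

Definition full_leaves (T : tree) : seq ngraph :=
  [seq F <- leaves T | #|` F| == #|edge G|].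

(* The multiset P_i attached to the i-th graph of Fs; i counts from 0. *)
Definition facets (Fs : seq ngraph) (i : nat) : seq ngraph :=
  let F := nth fset0 Fs i in
  [seq Q <- [seq F `&` F' | F' <- take i Fs] | #|` Q|.+1 == #|` F|].

(* Formal sums of graphs are sequences of graphs up to perm_eq; this is the
   bilinear extension of the intersection of graphs. *)
Definition gmul (s t : seq ngraph) : seq ngraph :=
  [seq A `&` B | A <- s, B <- t].

(* The product of the sums F + Q for Q in P, and F if P is empty. *)
Definition gprod (F : ngraph) (P : seq ngraph) : seq ngraph :=
  if P is Q :: P' then
    foldl (fun s Q' => gmul s [:: F; Q']) [:: F; Q] P'
  else [:: F].

(* Intersection of a nonempty family; the value on [::] is irrelevant. *)
Definition gcap (S : seq ngraph) : ngraph :=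
  if S is Q :: S' then foldl (fun A B => A `&` B) Q S' else fset0.

(* The graphs gcap S for S a nonempty sub-multiset of P. *)
Definition gcaps (P : seq ngraph) : seq ngraph :=
  [seq gcap (mask m P) | m : (size P).-tuple bool <- enum {: (size P).-tuple bool}
                       & true \in m].

End Defs.

(* Main.v *)
Require Import Defs.
From HB Require Import structures.
From mathcomp Require Import all_boot all_order all_algebra finmap zify.
From Stdlib Require Import ClassicalEpsilon.

(** A node [H] with children [H1], [H3], [H2], reduced on [a] and [b], has its
    full dimensional leaves in [H1] and [H2].  By induction, the leaves below
    [H1] and [H2] are the [F `\` S] for [F] a full dimensional leaf and [S] a
    set of removable edges of [F], those [y] with [F `\ y] a facet of an earlier
    leaf.  Since [H3] is [H2] without [b] and also [H1] without [a], everything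
    rests on comparing the tree of a graph [H] with that of [H] without an
    edge [e]: the full dimensional leaves of the latter are the [F `\ x] where
    [F] is one of the former and [x] is the only edge of [F] whose expansion over
    [H] involves [e]; if moreover [e] can never become a minimal in-edge
    ([protects] below), then [F] and [F `\ x] have the same removable edges.
    The new removable edges of a leaf [F] below [H2] are then those [x] for
    [e := b], and they account exactly for the leaves below [H3]. *)

Set Implicit Arguments.
Unset Strict Implicit.
Unset Printing Implicit Defensive.

Import GRing.Theory.
Local Open Scope fset_scope.

(** * Finite sets and products of graphs *)

Section FinSets.
Variable K : choiceType.
Implicit Types (A B C : {fset K}) (x y z : K).

Lemma fsetD1AC A x y : A `\ x `\ y = A `\ y `\ x.
Proof. by rewrite !fsetDDl fsetUC. Qed.

Lemma fsetD1U1 A x y : y != x -> (A `|` [fset x]) `\ y = (A `\ y) `|` [fset x].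
Proof. by move=> yx; rewrite fsetDUl [[fset x] `\ y]mem_fsetD1 // in_fset1. Qed.

Lemma fset_exchange_del A x y z : z != x ->
  A `\ z `\ y `|` [fset x] = (A `\ y `|` [fset x]) `\ z.
Proof. by move=> zx; rewrite fsetD1U1 // fsetD1AC. Qed.

Lemma fsetU1D1 A x y : x \notin A -> (A `\ y `|` [fset x]) `\ x = A `\ y.
Proof. by move=> xA; rewrite fsetUC fsetU1K // in_fsetD1 (negPf xA) andbF. Qed.

Lemma cardfs_exchange A x y : y \in A -> x \notin A ->
  #|` A `\ y `|` [fset x]| = #|` A|.
Proof.
move=> yA xA; rewrite fsetUC cardfsU1 (cardfsD1 y A) yA in_fsetD1 (negPf xA).
by rewrite andbF.
Qed.

Lemma fsetI_disjD A B C : A `&` C = fset0 -> A `&` (B `\` C) = A `&` B.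
Proof.
move=> AC; apply/fsetP => x; rewrite !in_fsetI in_fsetD.
case: (boolP (x \in A)) => //= xA; suff -> : x \notin C by [].
apply/negP => xC; have : x \in A `&` C by rewrite in_fsetI xA.
by rewrite AC in_fset0.
Qed.

Lemma fset_sepD A B (P : pred K) :
  [fset x in A `\` B | P x] = [fset x in A | P x] `\` B.
Proof. by apply/fsetP => x; rewrite !inE andbA. Qed.

Lemma seq_of_fset1 x : [fset x] = [:: x] :> seq K.
Proof.
apply: perm_small_eq => //; apply: uniq_perm => // y.
by rewrite in_fset1 inE.
Qed.

End FinSets.

Section Products.
Variable K : choiceType.
Implicit Types (A B F Q : {fset K}) (P : seq {fset K}) (r : seq K).

(** The common normal form of the two sums in the theorem: the intersections of [A] with every
    sub-multiset of [P], the empty one included, built by splitting off one factor at a time. *)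
Fixpoint caps A P : seq {fset K} :=
  if P is Q :: P' then caps A P' ++ caps (A `&` Q) P' else [:: A].

Lemma caps_mid A P Q P' : perm_eq (caps A (P ++ Q :: P')) (caps A (Q :: P ++ P')).
Proof.
elim: P A => [//|B P IH] A /=.
apply: perm_trans (perm_cat (IH A) (IH (A `&` B))) _ => /=.
by rewrite (fsetIAC A Q B) perm_catACA.
Qed.

Lemma perm_caps A P P' : perm_eq P P' -> perm_eq (caps A P) (caps A P').
Proof.
elim: P A P' => [|Q P IH] A P' PP.
  by rewrite perm_sym in PP; rewrite (perm_nilP PP).
have QP' : Q \in P' by rewrite -(perm_mem PP) inE eqxx.
case/splitPr: QP' PP => P1 P2; rewrite perm_sym -cat1s perm_catCA perm_cons perm_sym => PP.
rewrite perm_sym; apply: perm_trans (caps_mid _ _ _ _) _ => /=; rewrite perm_sym.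
by apply: perm_cat; apply: IH.
Qed.

Definition removals F r : seq {fset K} := [seq F `\ y | y <- r].

(** For [A] inside [F], intersecting with [F] minus [y] only deletes [y] from [A], so the ambient
    graph does not matter. *)
Lemma caps_removals A F F' r : A `<=` F -> A `<=` F' ->
  caps A (removals F r) = caps A (removals F' r).
Proof.
elim: r A => //= y r IH A AF AF'.
have AD B : A `<=` B -> A `&` (B `\ y) = A `\ y by rewrite fsetIDA => /fsetIidPl->.
by rewrite !AD // !IH // (fsubset_trans (fsubD1set _ _)).
Qed.

Definition facets_in F (Fs : seq {fset K}) :=
  [seq Q <- [seq F `&` F' | F' <- Fs] | #|` Q|.+1 == #|` F|].

Lemma facets_in_cat F Fs Fs' : facets_in F (Fs ++ Fs') = facets_in F Fs ++ facets_in F Fs'.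
Proof. by rewrite /facets_in map_cat filter_cat. Qed.

(** Each intersection misses all of [E], hence at least two edges of [F]. *)
Lemma facets_in_nil F E Fs : (1 < #|` E|)%N -> E `<=` F ->
  {in Fs, forall F', F `&` F' `<=` F `\` E} -> facets_in F Fs = [::].
Proof.
move=> E1 EF sub; rewrite /facets_in filter_map (eq_in_filter (a2 := pred0)) ?filter_pred0 //.
move=> F' /sub/fsubset_leq_card; rewrite (cardfsDS EF) => le.
by apply/negbTE; rewrite /= neq_ltn; apply/orP; left; have := fsubset_leq_card EF; lia.
Qed.

(** A facet inside [Q] has the cardinality of [Q], hence equals it. The multiplicity is recorded
    because the facets form a multiset. *)
Lemma facets_in_nseq F Q Fs : Q `<=` F -> #|` Q|.+1 = #|` F| ->
  {in Fs, forall F', F `&` F' `<=` Q} ->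
  facets_in F Fs = nseq (count (fun F' => Q `<=` F') Fs) Q.
Proof.
move=> QF cQ; elim: Fs => //= F' Fs IH sub.
have {}IH : facets_in F Fs = nseq (count (fun F' => Q `<=` F') Fs) Q.
  by apply: IH => A AF; apply: sub; rewrite inE AF orbT.
have subF' : F `&` F' `<=` Q by apply: sub; rewrite inE eqxx.
rewrite /facets_in /= -/(facets_in F Fs) -cQ eqSS.
case: (boolP (Q `<=` F')) => QF'.
  have -> : F `&` F' = Q by apply/eqP; rewrite eqEfsubset subF' fsubsetI QF.
  by rewrite eqxx IH.
case: eqP => // eqc; case/negP: QF'.
have /eqP <- : F `&` F' == Q by rewrite eqEfcard subF' eqc leqnn.
exact: fsubsetIr.
Qed.

(** The bit sequences are listed in the order in which the recursion of [caps] meets the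
    sub-multisets. *)
Fixpoint masks m : seq bitseq :=
  if m is m'.+1 then map (cons false) (masks m') ++ map (cons true) (masks m') else [:: [::]].

Lemma mem_masks m t : (t \in masks m) = (size t == m).
Proof.
have consI (c : bool) : injective (cons c) by move=> x y [].
elim: m t => [|m IH] [|b t] //=; rewrite mem_cat.
  by apply/negbTE/negP => /orP[] /mapP[].
have consN c : ((~~ c) :: t \in map (cons c) (masks m)) = false.
  by apply/negbTE/negP => /mapP[x _ []]; case: c.
by case: b; rewrite (mem_map (consI _)) IH ?(consN true) ?(consN false) ?orbF.
Qed.

Lemma masks_uniq m : uniq (masks m).
Proof.
elim: m => //= m IH; rewrite cat_uniq !map_inj_uniq ?IH ?andbT //=; try by move=> x y [].
by apply/hasPn => t /mapP[x _ ->]; apply/negP => /mapP[].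
Qed.

Lemma caps_masks A P : caps A P = [seq foldl (@fsetI K) A (mask m P) | m <- masks (size P)].
Proof.
elim: P A => //= Q P IH A; rewrite map_cat -!map_comp !IH; congr (_ ++ _).
Qed.

End Products.

(** * Expansion of edges over a node *)

Section Coefficients.
Variables (n : nat) (G : multigraph n).
Implicit Types (H K F : ngraph G) (a b e h s y : nedge G).
Implicit Types m : nedge G -> nat.

Definition comb H m : fsum G := (\sum_(h <- H) nsum h *+ m h)%R.

Definition cone H y := exists m, nsum y = comb H m.

(** Uniqueness of natural number coefficients, which makes the expansion of a leaf edge over a node
    well defined. *)
Definition indep H := forall m m', comb H m = comb H m' -> {in H, m =1 m'}.

(* Junk unless [cone H y]. *)
Definition coef H y : nedge G -> nat :=
  epsilon (inhabits (fun=> 0)) (fun m => nsum y = comb H m).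

Lemma coefP H y : cone H y -> nsum y = comb H (coef H y).
Proof. exact: epsilon_spec. Qed.

Lemma coefE H y m : indep H -> nsum y = comb H m -> {in H, coef H y =1 m}.
Proof. by move=> iH yE; apply: iH; rewrite -yE -coefP //; exists m. Qed.

Lemma eq_comb H m m' : {in H, m =1 m'} -> comb H m = comb H m'.
Proof. by move=> mm'; apply: eq_big_seq => h hH; rewrite mm'. Qed.

Lemma combD1 H a m : a \in H -> comb H m = (nsum a *+ m a + comb (H `\ a) m)%R.
Proof. by move=> aH; rewrite /comb (big_fsetD1 a). Qed.

Lemma combU1 H s m : s \notin H ->
  comb (H `|` [fset s]) m = (nsum s *+ m s + comb H m)%R.
Proof. by move=> sH; rewrite fsetUC /comb big_fsetU1. Qed.

Lemma comb_supp H a m : a \in H -> m a = 0 -> comb H m = comb (H `\ a) m.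
Proof. by move=> aH m0; rewrite (combD1 _ aH) m0 mulr0n add0r. Qed.

Lemma comb_delta H a : a \in H -> comb H (fun h => h == a) = nsum a.
Proof.
move=> aH; rewrite (combD1 _ aH) eqxx mulr1n /comb big_seq big1 ?addr0 //.
by move=> h; rewrite !inE => /andP[/negPf-> _].
Qed.

Lemma combMD H m m' : (comb H m + comb H m')%R = comb H (fun h => (m h + m' h)%N).
Proof. by rewrite /comb -big_split; apply: eq_bigr => h _; rewrite /= mulrnDr. Qed.

Lemma cone_mem H y : y \in H -> cone H y.
Proof. by move=> yH; exists (fun h => h == y); rewrite comb_delta. Qed.

Lemma coef_mem H y h : indep H -> y \in H -> h \in H -> coef H y h = (h == y).
Proof. by move=> iH yH hH; apply: (coefE (m := fun h => h == y)); rewrite ?comb_delta. Qed.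

Lemma indep_del H e : e \in H -> indep H -> indep (H `\ e).
Proof.
move=> eH iH m m' mm' h hHe.
pose ext m h := if h == e then 0 else m h.
have extE m0 : comb (H `\ e) m0 = comb H (ext m0).
  rewrite (comb_supp eH) /ext ?eqxx //; apply: eq_comb => h0.
  by rewrite !inE => /andP[/negPf->].
move: hHe mm'; rewrite !inE => /andP[/negPf he hH]; rewrite !extE.
by move/iH => /(_ h hH); rewrite /ext he.
Qed.

Lemma coef_del H e y h : indep H -> e \in H -> cone (H `\ e) y ->
  h \in H `\ e -> coef (H `\ e) y h = coef H y h.
Proof.
move=> iH eH cy; rewrite !inE => /andP[he hH].
rewrite (coefE (H := H) (m := fun h => if h == e then 0 else coef (H `\ e) y h)) //.
  by rewrite (negPf he).
rewrite (comb_supp eH) ?eqxx // (coefP cy).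
by apply: eq_comb => h0; rewrite !inE => /andP[/negPf->].
Qed.

Definition containing H e F : ngraph G := [fset y in F | 0 < coef H y e].

(** The neighbourhood of [S] in the bipartite graph that joins each edge of [H] to the edges of [F]
    whose expansion involves it. *)
Definition meeting H (S F : ngraph G) : ngraph G :=
  [fset y in F | has (fun h => 0 < coef H y h) S].

Lemma eq_containing H K e f F :
  (forall y, y \in F -> coef H y e = coef K y f) ->
  containing H e F = containing K f F.
Proof.
by move=> eF; apply/fsetP => y; rewrite !inE; case: (boolP (y \in F)) => //= /eF->.
Qed.

Lemma in_containing H e F y :
  (y \in containing H e F) = (y \in F) && (0 < coef H y e)%N.
Proof. by rewrite !inE. Qed.

Lemma containing_sub H e F : containing H e F `<=` F.
Proof. exact: fset_sub. Qed.

Lemma containing_self H e : indep H -> e \in H -> containing H e H = [fset e].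
Proof.
move=> iH eH; apply/fsetP => y; rewrite !inE.
case: (boolP (y \in H)) => [yH|]; first by rewrite coef_mem // lt0b eq_sym.
by case: eqP => // ->; rewrite eH.
Qed.

(** * Replacing one of two edges by their sum *)

Section Exchange.
Variables (H : ngraph G) (a b s : nedge G).
Hypotheses (iH : indep H) (aH : a \in H) (bH : b \in H) (ab : a != b).
Hypothesis sE : nsum s = (nsum a + nsum b)%R.

(** Otherwise [s] would have two expansions over [H]: itself, and [a] plus [b]. *)
Lemma sum_notin : s \notin H.
Proof.
apply/negP => sH.
have /iH E : comb H (fun h => h == s) = comb H (fun h => ((h == a) + (h == b))%N).
  by rewrite -combMD !comb_delta.
have as_ : a = s.
  by have := E a aH; rewrite /= eqxx (negPf ab) addn0; case: eqP.
by have := E b bH; rewrite /= -as_ eqxx eq_sym (negPf ab).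
Qed.

(** With [a] and [b] in either order, this one exchange yields both [red1] and [red2]. *)
Let K := (H `\ b) `|` [fset s].

(** Coefficients over [K] rewritten over [H] by substituting [a + b] for [s]. *)
Let pull m h := if h == a then (m a + m s)%N else if h == b then m s else m h.

Let comb_pull m : comb K m = comb H (pull m).
Proof.
have sHb : s \notin H `\ b by rewrite !inE (negPf sum_notin) andbF.
have aHb : a \in H `\ b by rewrite !inE ab.
have Ka := etrans (combU1 m sHb) (congr1 (GRing.add _) (combD1 m aHb)).
have Ha := etrans (combD1 (pull m) bH) (congr1 (GRing.add _) (combD1 (pull m) aHb)).
apply: etrans Ka _; apply: etrans (esym Ha).
have <- : comb (H `\ b `\ a) m = comb (H `\ b `\ a) (pull m).
  by apply: eq_comb => h; rewrite /pull !in_fsetD1 => /and3P[/negPf-> /negPf->].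
move: (comb _ m) => c.
rewrite /pull eqxx (eq_sym b a) (negPf ab) eqxx sE mulrnDl mulrnDr !addrA.
by congr (_ + _)%R; rewrite addrAC (addrC (nsum a *+ _)%R).
Qed.

(** After [pull], the coefficient at [b] is that of [s]; the one at [a] then gives that of [a] by
    cancellation. *)
Lemma exchange_indep : indep K.
Proof.
move=> m m'; rewrite !comb_pull => /iH E.
have := E b bH; have := E a aH.
rewrite /pull eqxx eq_sym (negPf ab) eqxx => Ea Es h.
rewrite in_fsetU in_fsetD1 in_fset1 => /orP[/andP[hb hH]|/eqP->//].
have := E h hH; rewrite /pull (negPf hb); case: eqP => // -> _.
by move: Ea; rewrite Es => /addIn.
Qed.

Lemma cone_exchange y : cone K y -> cone H y.
Proof. by move=> [m yE]; exists (pull m); rewrite -comb_pull. Qed.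

Lemma coef_exchange y h : cone K y -> h \in H ->
  coef H y h = if h == a then (coef K y a + coef K y s)%N
               else if h == b then coef K y s else coef K y h.
Proof.
move=> cy hH; rewrite (coefE (H := H) (m := pull (coef K y))) //.
by rewrite -comb_pull -coefP.
Qed.

Lemma coef_exchange_kept y : cone K y -> coef H y a = (coef K y a + coef K y s)%N.
Proof. by move=> cy; rewrite (coef_exchange cy aH) eqxx. Qed.

Lemma coef_exchange_new y : cone K y -> coef H y b = coef K y s.
Proof. by move=> cy; rewrite (coef_exchange cy bH) eq_sym (negPf ab) eqxx. Qed.

Lemma containing_exchange_new F : (forall y, y \in F -> cone K y) ->
  containing H b F = containing K s F.
Proof.
move=> cF; apply: eq_containing => y yF.
by rewrite (coef_exchange_new (cF _ yF)).
Qed.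

Lemma containing_exchange_kept F : (forall y, y \in F -> cone K y) ->
  containing H a F = containing K a F `|` containing K s F.
Proof.
move=> cF; apply/fsetP => y; rewrite !inE; case: (boolP (y \in F)) => //= yF.
by rewrite (coef_exchange_kept (cF _ yF)) addn_gt0.
Qed.

Lemma containing_exchange_other F h : (forall y, y \in F -> cone K y) ->
  h \in H -> h != a -> h != b -> containing H h F = containing K h F.
Proof.
move=> cF hH ha hb; apply: eq_containing => y yF.
by rewrite (coef_exchange (cF _ yF) hH) (negPf ha) (negPf hb).
Qed.

(** [S1] is [S] with [b], if present, traded for [s]. An edge involving [s] over [K] involves [b]
    over [H], and the coefficients of the other members of [S] can only grow from [K] to [H]. *)
Lemma meeting_exchange S : S `<=` H ->
  exists S1, [/\ S1 `<=` K, #|` S1| = #|` S| &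
    forall F, (forall y, y \in F -> cone K y) -> meeting K S1 F `<=` meeting H S F].
Proof.
move=> SH; have sS : s \notin S by apply: contra sum_notin; apply/fsubsetP.
have meet1 F S1 : (forall y, y \in F -> cone K y) ->
    (forall h, h \in S1 -> h \in S /\ h != b \/ h = s /\ b \in S) ->
    meeting K S1 F `<=` meeting H S F.
  move=> cF S1S; apply/fsubsetP => y; rewrite !inE => /andP[yF /hasP[h hS1 ch]].
  rewrite yF /=; apply/hasP; case: (S1S _ hS1) => [[hS hb]|[hs bS]].
    exists h => //; rewrite (coef_exchange (cF _ yF) (fsubsetP SH _ hS)).
    by rewrite (negPf hb); case: eqP ch => // -> ; rewrite addn_gt0 => ->.
  by exists b => //; rewrite (coef_exchange_new (cF _ yF)) -hs.
case: (boolP (b \in S)) => bS; [exists ((S `\ b) `|` [fset s])|exists S]; split=> //.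
- exact/fsetSU/fsetSD.
- exact: cardfs_exchange.
- move=> F cF; apply: meet1 => // h; rewrite in_fsetU in_fsetD1 in_fset1.
  by case/orP=> [/andP[-> ->]|/eqP->]; [left|right].
- apply/fsubsetP => h hS; rewrite in_fsetU in_fsetD1 (fsubsetP SH) // andbT.
  by case: eqP => // hb; rewrite -hb hS in bS.
- move=> F cF; apply: meet1 => // h hS; left; split=> //.
  by apply: contraNneq bS => <-.
Qed.

End Exchange.

End Coefficients.

(** * The order O *)

Section Order.
Variables (n : nat) (G : multigraph n) (le_in le_out : rel (fsum G)).
Hypotheses (hin : tie_order le_in) (hout : tie_order le_out).
Implicit Types (H K F : ngraph G) (a b c d e h s x y z : nedge G).

(** At a fixed target this is the preference of the order O among in-edges; it is antisymmetric only
    once the targets agree. *)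
Definition before x y : bool :=
  (nsrc x < nsrc y)%N || (nsrc x == nsrc y) && le_in (nsum x) (nsum y).

Lemma beforeP x y :
  reflect ((nsrc x < nsrc y)%N \/ nsrc x = nsrc y /\ le_in (nsum x) (nsum y))
    (before x y).
Proof.
by apply: (iffP orP) => -[?|]; [left|case/andP=> /eqP; right|left|case=> /eqP-> ->; right].
Qed.

Lemma before_trans : transitive before.
Proof.
move=> y x z; have [_ _ tr _] := hin.
case/beforeP=> [xy|[xy lxy]] /beforeP[yz|[yz lyz]]; apply/beforeP.
- by left; apply: ltn_trans xy yz.
- by left; rewrite -yz.
- by left; rewrite xy.
- by right; split; [rewrite xy|apply: tr lxy lyz].
Qed.

Lemma before_total : total before.
Proof.
move=> x y; rewrite /before; case: (ltngtP (nsrc x) (nsrc y)) => //=;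
  rewrite ?orbT // => /ord_inj->.
by rewrite eqxx; case: hin => + _ _ _; apply.
Qed.

Lemma before_refl : reflexive before.
Proof. by move=> x; have := before_total x x; rewrite orbb. Qed.

Lemma before_anti x y : ntgt x = ntgt y -> before x y -> before y x -> x = y.
Proof.
case: x y => [[x1 x2] x3] [[y1 y2] y3]; have [_ anti _ _] := hin.
move=> + /beforeP + /beforeP; rewrite /nsrc /ntgt /nsum /= => ->.
move=> [xy|[-> xy]] [yx|[E yx]]; [|..|by rewrite (anti x3 y3) ?xy].
- by have := ltn_trans xy yx; rewrite ltnn.
- by rewrite E ltnn in xy.
- by rewrite ltnn in yx.
Qed.

(** Ties survive because the tie order is compatible with addition of formal sums. *)
Lemma before_join x y z : before x y -> before (join_edge x z) (join_edge y z).
Proof.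
have [_ _ _ add] := hin.
by case/beforeP=> [?|[xy lxy]]; apply/beforeP; [left|right; split=> //; apply: add].
Qed.

Definition wf H := forall h, h \in H -> (nsrc h < ntgt h)%N.

Definition good H := indep H /\ wf H.

Definition step H a b : Prop :=
  [/\ a \in H, b \in H, composable a b & order_O le_in le_out H a b].

Lemma composableE H a b : wf H -> a \in H -> b \in H ->
  composable a b = (ntgt a == nsrc b).
Proof. by move=> w aH bH; rewrite /composable !w // andbT. Qed.

Lemma good_del H e : e \in H -> good H -> good (H `\ e).
Proof.
move=> eH [iH w]; split; first exact: indep_del.
by move=> h; rewrite !inE => /andP[_ /w].
Qed.

(** Both pairs meet at the same least vertex, so each in-edge competes with the other, and likewise
    the out-edges; antisymmetry of the tie orders then decides. *)
Lemma step_fun H a b a' b' : step H a b -> step H a' b' -> a = a' /\ b = b'.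
Proof.
case=> aH bH ab [min_v min_a max_b] [a'H b'H ab' [min_v' min_a' max_b']].
have [_ anti_out _ _] := hout.
have vE : ntgt a = ntgt a'.
  by apply/val_inj/eqP; rewrite eqn_leq (min_v _ b') // (min_v' _ b).
move: (ab) (ab') => /and3P[wa /eqP va wb] /and3P[wa' /eqP va' wb'].
have a'b : composable a' b by rewrite /composable wa' wb -vE va eqxx.
have ab'' : composable a b' by rewrite /composable wa wb' vE va' eqxx.
have aE : a = a'.
  by apply: before_anti => //; apply/beforeP; [apply: min_a|apply: min_a'].
split=> //; subst a'.
have := max_b b' b'H ab''; have := max_b' b bH a'b.
have: nsrc b = nsrc b' by rewrite -va.
case: (b) (b') => [[b1 b2] b3] [[c1 c2] c3]; rewrite /nsrc /ntgt /nsum /= => ->.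
case=> [lt_bc|[-> bc]] [lt_cb|[E cb]]; [|..|by rewrite (anti_out b3 c3) ?bc].
- by have := ltn_trans lt_bc lt_cb; rewrite ltnn.
- by rewrite E ltnn in lt_bc.
- by rewrite ltnn in lt_cb.
Qed.

Lemma order_O_sub H K a b : (forall h, h \in K -> h \in H) ->
  order_O le_in le_out H a b -> order_O le_in le_out K a b.
Proof.
move=> KH [o1 o2 o3]; split=> [a' b' /KH a'H /KH b'H|a' /KH a'H|b' /KH b'H].
- exact: o1.
- exact: o2.
- exact: o3.
Qed.

(** The extremal conditions of the order O only weaken on a subgraph, so a surviving pair stays the
    selected one. *)
Lemma step_del H a b e : a != e -> b != e -> step H a b -> step (H `\ e) a b.
Proof.
move=> ae be [aH bH ab o]; split; rewrite ?inE ?ae ?be //.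
by apply: order_O_sub o => h; rewrite !inE => /andP[].
Qed.

Definition cuts H (v : nat) :=
  forall c d, c \in H -> d \in H -> composable c d -> (v <= ntgt c)%N.

(* In the order O the edge [e] is then never again a minimal in-edge of its
   target, which would make its removal interfere with the order. *)
Definition protects H e' e : Prop :=
  [/\ e' \in H, e' != e, ntgt e' = ntgt e, before e' e
    & (forall a, a \in H -> composable a e -> before e' (join_edge a e))
      /\ cuts H (nsrc e)].

Definition protected H e : Prop := exists e', protects H e' e.

Lemma protects_del H e' e h : e' != h -> protects H e' e -> protects (H `\ h) e' e.
Proof.
move=> e'h [e'H e'e te be [ba cu]]; split; rewrite ?inE ?e'h //.
split=> [a|c d]; rewrite !inE => /andP[_ aH]; first exact: ba.
by move=> /andP[_ dH]; apply: cu.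
Qed.

(** * A single reduction step and its effect on protection *)

Section Step.
Variables (H : ngraph G) (a b : nedge G).
Hypotheses (gH : good H) (st : step H a b).
Let s := join_edge a b.
Let v := ntgt a.
Let iH : indep H. Proof. by case: gH. Qed.
Let wH : wf H. Proof. by case: gH. Qed.
Let aH : a \in H. Proof. by case: st. Qed.
Let bH : b \in H. Proof. by case: st. Qed.

Lemma step_mid : ntgt a = nsrc b.
Proof. by case: st => _ _ /and3P[_ /eqP]. Qed.

Let vb : nsrc b = v. Proof. by rewrite -step_mid. Qed.

Lemma step_lt : (nsrc a < v)%N /\ (v < ntgt b)%N.
Proof. by split; [apply: wH|rewrite -vb wH]. Qed.

Lemma step_neq : a != b.
Proof. by apply/eqP => ab; have [] := step_lt; rewrite -ab /v ltnn. Qed.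

Lemma join_notin : s \notin H.
Proof. by apply: (sum_notin iH aH bH step_neq). Qed.

Lemma join_neq h : h \in H -> h != s.
Proof. by move=> hH; apply: contraNneq join_notin => <-. Qed.

Lemma mem_red1 h : (h \in red1 H a b) = (h != b) && (h \in H) || (h == s).
Proof. by rewrite /red1 /red2 in_fsetU in_fsetD1 in_fset1. Qed.

Lemma mem_red2 h : (h \in red2 H a b) = (h != a) && (h \in H) || (h == s).
Proof. by rewrite /red1 /red2 in_fsetU in_fsetD1 in_fset1. Qed.

Lemma good_red1 : good (red1 H a b).
Proof.
split; first exact: (exchange_indep iH aH bH step_neq).
move=> h; rewrite mem_red1 => /orP[/andP[_ /wH//]|/eqP->].
by have [l1 l2] := step_lt; apply: ltn_trans l1 l2.
Qed.

Lemma good_red2 : good (red2 H a b).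
Proof.
split; first by apply: (exchange_indep iH bH aH); rewrite 1?eq_sym ?step_neq // addrC.
move=> h; rewrite mem_red2 => /orP[/andP[_ /wH//]|/eqP->].
by have [l1 l2] := step_lt; apply: ltn_trans l1 l2.
Qed.

Lemma red3_red1 : red3 H a b = red1 H a b `\ a.
Proof. exact: fset_exchange_del (join_neq aH). Qed.

Lemma red3_red2 : red3 H a b = red2 H a b `\ b.
Proof. exact: esym (fsetD1U1 _ (join_neq bH)). Qed.

(** Lets the deletion of [b] from [H] be treated as the deletion of the new edge from the left
    child. *)
Lemma red1_join : red1 H a b `\ s = H `\ b.
Proof. exact: fsetU1D1 join_notin. Qed.

Lemma red2_join : red2 H a b `\ s = H `\ a.
Proof. exact: fsetU1D1 join_notin. Qed.

Lemma red1_del e : e \in H -> red1 (H `\ e) a b = red1 H a b `\ e.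
Proof. move/join_neq; exact: fset_exchange_del. Qed.

Lemma red2_del e : e \in H -> red2 (H `\ e) a b = red2 H a b `\ e.
Proof. move/join_neq; exact: fset_exchange_del. Qed.

Lemma card_red1 : #|` red1 H a b| = #|` H|.
Proof. exact: cardfs_exchange bH join_notin. Qed.

Lemma card_red2 : #|` red2 H a b| = #|` H|.
Proof. exact: cardfs_exchange aH join_notin. Qed.

Lemma card_red3 : (#|` red3 H a b|.+1 = #|` H|)%N.
Proof.
rewrite red3_red1 -card_red1 (cardfsD1 a (red1 H a b)) mem_red1.
by rewrite step_neq aH.
Qed.

Lemma step_cuts c d : c \in H -> d \in H -> composable c d -> (v <= ntgt c)%N.
Proof. by case: st => _ _ _ [+ _ _]; apply. Qed.

(** An edge preceding [s] also precedes [a] in [H], where minimality of [v] applies; a pair starting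
    with [s] meets at the target of [b], beyond [v]. *)
Let cuts_exchange K u : (forall h, h \in K -> h \in H \/ h = s) -> (u <= v)%N ->
  cuts K u.
Proof.
have [l1 l2] := step_lt.
move=> KH uv c d /KH[cH|->] /KH[dH|->] cd.
- exact: leq_trans uv (step_cuts cH dH cd).
- apply: leq_trans uv (step_cuts cH aH _); rewrite (composableE wH) //.
  by case/and3P: cd.
- exact: leq_trans uv (ltnW l2).
- exact: leq_trans uv (ltnW l2).
Qed.

Lemma cuts_red1 u : (u <= v)%N -> cuts (red1 H a b) u.
Proof.
apply: cuts_exchange => h.
by rewrite mem_red1 => /orP[/andP[_]|/eqP]; [left|right].
Qed.

Lemma cuts_red2 u : (u <= v)%N -> cuts (red2 H a b) u.
Proof.
apply: cuts_exchange => h.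
by rewrite mem_red2 => /orP[/andP[_]|/eqP]; [left|right].
Qed.

Lemma before_join_snd : before s b.
Proof. by apply/beforeP; left; rewrite vb; case: step_lt. Qed.

Lemma step_min a' : a' \in H -> ntgt a' = v -> before a a'.
Proof.
move=> a'H ta'; apply/beforeP; case: st => _ _ _ [_ + _]; apply => //.
by rewrite (composableE wH) // ta' vb.
Qed.

(** An in-edge [a'] left at [v] comes after the minimal one [a], and adding [b] preserves this, so
    [a' + b] comes after [s]. *)
Lemma protects_join : protects (red2 H a b) s b.
Proof.
split; first by rewrite mem_red2 eqxx orbT.
- by rewrite eq_sym join_neq.
- by [].
- exact: before_join_snd.
split; last by apply: cuts_red2; rewrite vb.
move=> a'; rewrite mem_red2 => /orP[/andP[_ a'H]|/eqP->] /and3P[_ /eqP ta' _].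
  by apply/before_join/step_min; rewrite // ta' vb.
by have [_] := step_lt; rewrite -vb -ta' ltnn.
Qed.

(** The reduced in-edge is minimal, so no other edge with its target comes before it. *)
Lemma not_protects_fst e' : ~ protects H e' a.
Proof.
case=> e'H e'a te be _; case/eqP: e'a.
exact/before_anti/step_min.
Qed.

Lemma protects_cut e' e : e \in H -> protects H e' e -> (nsrc e <= v)%N.
Proof. by move=> eH [_ _ _ _ [_ cu]]; apply: cu aH bH _; case: st. Qed.

(** Protection of [b] already asks [e'] to come before [a + b], which is the new edge. Nothing can
    precede the new edge, since the meeting vertex would be smaller than [v]. *)
Lemma protects_red1_join e' : protects H e' b -> protects (red1 H a b) e' s.
Proof.
case=> e'H e'b te be [ba cu]; have [l1 l2] := step_lt.
have ab : composable a b by case: st.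
split=> //; first by rewrite mem_red1 e'b e'H.
- exact: join_neq.
- exact: ba.
split; last by apply: cuts_red1; apply: ltnW.
move=> a'; rewrite mem_red1 => /orP[/andP[_ a'H]|/eqP->] /and3P[wa' /eqP ta' _].
  have /(step_cuts a'H aH) : composable a' a by rewrite (composableE wH) // ta'.
  by rewrite ta' leqNgt l1.
by have := ltn_trans l1 l2; rewrite [ntgt b]ta' ltnn.
Qed.

(** The protector is lost only if it is [b]; then the new edge, which comes before [b] and has its
    target, takes over. *)
Lemma protected_red1 e' e : e \in H -> e != b -> protects H e' e ->
  protected (red1 H a b) e.
Proof.
move=> eH eb pe; have ev := protects_cut eH pe; move: pe => [e'H e'e te be [ba cu]].
have [l1 l2] := step_lt.
have sub f : before f e' -> forall a', a' \in red1 H a b -> composable a' e ->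
    before f (join_edge a' e).
  move=> fe' a'; rewrite mem_red1 => /orP[/andP[_ a'H]|/eqP->] a'e.
    exact: before_trans fe' (ba _ a'H a'e).
  by case/and3P: a'e => _ /eqP tb _; move: ev; rewrite -tb leqNgt l2.
case: (e' =P b) => [e'b|/eqP e'b]; [exists s|exists e']; split=> //.
- by rewrite mem_red1 eqxx orbT.
- by rewrite eq_sym join_neq.
- by rewrite -te e'b.
- by apply: before_trans be; rewrite e'b before_join_snd.
- by split; [apply: sub; rewrite e'b before_join_snd|apply: cuts_red1].
- by rewrite mem_red1 e'b e'H.
- by split; [apply: sub (before_refl _)|apply: cuts_red1].
Qed.

Lemma protects_red2 e' e : e \in H -> e' != a -> protects H e' e ->
  protects (red2 H a b) e' e.
Proof.
move=> eH e'a pe; have ev := protects_cut eH pe; move: pe => [e'H e'e te be [ba cu]].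
split=> //; first by rewrite mem_red2 e'a e'H.
split; last exact: cuts_red2.
move=> a'; rewrite mem_red2 => /orP[/andP[_ a'H]|/eqP->] a'e; first exact: ba.
by case/and3P: a'e => _ /eqP tb _; move: ev; rewrite -tb leqNgt; case: step_lt => _ ->.
Qed.

End Step.

(* If [a] was the only edge protecting [e], then [e] is the next in-edge to be
   reduced, and the protection passes to the sum [e + b]. *)
Lemma protected_red2 H a b e' e (s := join_edge a b) :
  good H -> step H a b -> e \in H -> e != a -> e != b -> protects H e' e ->
  protected (red2 H a b) e
  \/ [/\ step (red2 H a b) e b,
         protects (red1 (red2 H a b) e b) s (join_edge e b)
       & protects (red2 (red2 H a b) e b) s (join_edge e b)].
Proof.
move=> gH st eH ea eb pe; have ev := protects_cut st eH pe.
have [e'H e'e te be [ba cu]] := pe.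
have [l1 l2] := step_lt gH st; have vb := esym (step_mid st).
have wH : wf H by case: gH.
have [aH bH _ _] := st.
case: (e' =P a) => [e'a|/eqP e'a]; last first.
  by left; exists e'; apply: protects_red2.
subst e'; have {}te : ntgt e = ntgt a by [].
(* [e] starts before [v], where no pair can be composed any more. *)
have noin a' : a' \in red2 H a b -> composable a' e -> False.
  rewrite mem_red2 => /orP[/andP[_ a'H]|/eqP->] /and3P[_ /eqP ta' w].
    have /(step_cuts st a'H eH) : composable a' e by rewrite (composableE wH) // ta'.
    by rewrite ta' leqNgt -te w.
  by move: ev; rewrite -ta' leqNgt -[ntgt (join_edge a b)]/(ntgt b) l2.
(* Another in-edge of [v] before [e] inherits the protection; without one, [e] is the minimal
   in-edge and is reduced next. *)
case: (boolP (has (fun f => [&& f != e, ntgt f == ntgt a & before f e]) (red2 H a b))).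
  case/hasP=> f fH /and3P[fe /eqP tf bf]; left; exists f; split=> //.
    by rewrite tf.
  by split; [move=> a' /noin A /A|apply: (cuts_red2 gH st)].
move=> /hasPn nof; right.
have e2 : e \in red2 H a b by rewrite mem_red2 ea eH.
have b2 : b \in red2 H a b by rewrite mem_red2 eq_sym (step_neq gH st) bH.
have s2 : s \in red2 H a b by rewrite mem_red2 eqxx orbT.
have g2 := good_red2 gH st; have w2 : wf (red2 H a b) by case: g2.
have st2 : step (red2 H a b) e b.
  split=> //; first by rewrite (composableE w2) // te vb.
  split=> [c d cH dH cd|c cH cb|d dH ed].
  - by rewrite te; apply: (cuts_red2 gH st (leqnn _)) cH dH cd.
  - apply/beforeP; case: (c =P e) => [->|/eqP ce]; first exact: before_refl.
    have tc : ntgt c = ntgt a by case/and3P: cb => _ /eqP->.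
    have := nof c cH; rewrite ce tc eqxx /=.
    by have := before_total c e; case: before.
  - move: dH; rewrite mem_red2 => /orP[/andP[_ dH]|/eqP dE].
      case: st => _ _ _ [_ _]; apply => //.
      by rewrite (composableE wH) //; case/and3P: ed => _; rewrite te.
    case/and3P: ed => _; rewrite te dE => /eqP E _.
    by move: l1; rewrite -[nsrc a]/(nsrc s) -E ltnn.
(* Since [a] comes before [e], the sum [s] of [a] and [b] comes before [e + b]; this serves both
   children of the next step. *)
have key K : (forall h, h \in K -> h \in red2 H a b \/ h = join_edge e b) ->
    s \in K -> cuts K (nsrc e) -> protects K s (join_edge e b).
  move=> Ksub sK cK; split=> //.
  - exact: (join_neq g2 st2 s2).
  - exact: before_join.
  split=> // a' /Ksub[a'2|->] a'e.
    case: (noin a' a'2); rewrite (composableE w2) //.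
    by case/and3P: a'e.
  case/and3P: a'e => _ /eqP tb _; move: ev; rewrite leqNgt.
  by rewrite -[nsrc e]/(nsrc (join_edge e b)) -tb l2.
split; [exact: st2|apply: key|apply: key].
- move=> h hK.
  have /orP[/andP[_ h2]|/eqP hE] : (h != b) && (h \in red2 H a b) || (h == join_edge e b).
    by rewrite -mem_red1.
  + by left; exact: h2.
  + by right.
- by rewrite mem_red1 s2 eq_sym (join_neq gH st).
- by apply: (cuts_red1 g2 st2); rewrite te.
- move=> h hK.
  have /orP[/andP[_ h2]|/eqP hE] : (h != e) && (h \in red2 H a b) || (h == join_edge e b).
    by rewrite -mem_red2.
  + by left; exact: h2.
  + by right.
- by rewrite mem_red2 s2 eq_sym (join_neq gH st).
- by apply: (cuts_red2 g2 st2); rewrite te.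
Qed.
End Order.

(** * Removable edges *)

Section Shelling.
Variables (n : nat) (G : multigraph n) (le_in le_out : rel (fsum G)).
Hypotheses (hin : tie_order le_in) (hout : tie_order le_out).
Implicit Types (H K F : ngraph G) (a b e h y : nedge G) (T : tree G).
Implicit Types (p : ngraph G * ngraph G) (s : seq (ngraph G * ngraph G)).

Local Notation step := (step le_in le_out).
Local Notation protects := (protects le_in).
Local Notation protected := (protected le_in).

Section StepContaining.
Variables (H : ngraph G) (a b : nedge G).
Hypotheses (gH : good H) (st : step H a b).
Let iH : indep H. Proof. by case: gH. Qed.
Let aH : a \in H. Proof. by case: st. Qed.
Let bH : b \in H. Proof. by case: st. Qed.
Let ab : a != b. Proof. exact: step_neq gH st. Qed.
Let ba : b != a. Proof. by rewrite eq_sym. Qed.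
Let joinE : nsum (join_edge a b) = (nsum a + nsum b)%R. Proof. by []. Qed.
Let sumE : nsum (join_edge a b) = (nsum b + nsum a)%R. Proof. exact: addrC. Qed.

Lemma cone_red1 y : cone (red1 H a b) y -> cone H y.
Proof. exact: (cone_exchange iH aH bH ab joinE). Qed.

Lemma cone_red2 y : cone (red2 H a b) y -> cone H y.
Proof. exact: (cone_exchange iH bH aH ba sumE). Qed.

(** Let [c1], [c2] be the coefficients over the two children and [s] the new edge. Comparing over
    [H] gives [c1 a + c1 s = c2 s] at [a] and [c1 s = c2 b + c2 s] at [b], which forces [c1 a] and
    [c2 b] to vanish. *)
Lemma coef_red2_both y : cone (red1 H a b) y -> cone (red2 H a b) y ->
  coef (red1 H a b) y a = 0 /\ coef (red2 H a b) y b = 0.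
Proof.
move=> c1 c2.
have arith (x u v w : nat) : (x + u = v -> u = w + v -> x = 0 /\ w = 0)%N by lia.
exact: arith
  (etrans (esym (coef_exchange_kept iH aH bH ab joinE c1))
          (coef_exchange_new iH bH aH ba sumE c2))
  (etrans (esym (coef_exchange_new iH aH bH ab joinE c1))
          (coef_exchange_kept iH bH aH ba sumE c2)).
Qed.

Lemma meeting_red1 S : S `<=` H ->
  exists S1, [/\ S1 `<=` red1 H a b, #|` S1| = #|` S| &
    forall F, (forall y, y \in F -> cone (red1 H a b) y) ->
      meeting (red1 H a b) S1 F `<=` meeting H S F].
Proof. exact: (meeting_exchange iH aH bH ab joinE). Qed.

Lemma meeting_red2 S : S `<=` H ->
  exists S1, [/\ S1 `<=` red2 H a b, #|` S1| = #|` S| &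
    forall F, (forall y, y \in F -> cone (red2 H a b) y) ->
      meeting (red2 H a b) S1 F `<=` meeting H S F].
Proof. exact: (meeting_exchange iH bH aH ba sumE). Qed.

Variable F : ngraph G.

Section Red1.
Hypothesis cF : forall y, y \in F -> cone (red1 H a b) y.

Lemma containing_red1_snd : containing H b F = containing (red1 H a b) (join_edge a b) F.
Proof. exact: (containing_exchange_new iH aH bH ab joinE). Qed.

Lemma containing_red1_fst : containing H a F =
  containing (red1 H a b) a F `|` containing (red1 H a b) (join_edge a b) F.
Proof. exact: (containing_exchange_kept iH aH bH ab joinE). Qed.

Lemma containing_red1 e : e \in H -> e != a -> e != b ->
  containing H e F = containing (red1 H a b) e F.
Proof. exact: (containing_exchange_other iH aH bH ab joinE). Qed.
End Red1.

Section Red2.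
Hypothesis cF : forall y, y \in F -> cone (red2 H a b) y.

Lemma containing_red2_fst : containing H a F = containing (red2 H a b) (join_edge a b) F.
Proof. exact: (containing_exchange_new iH bH aH ba sumE). Qed.

Lemma containing_red2_snd : containing H b F =
  containing (red2 H a b) b F `|` containing (red2 H a b) (join_edge a b) F.
Proof. exact: (containing_exchange_kept iH bH aH ba sumE). Qed.

Lemma containing_red2 e : e \in H -> e != a -> e != b ->
  containing H e F = containing (red2 H a b) e F.
Proof. by move=> eH ea eb; exact: (containing_exchange_other iH bH aH ba sumE cF eH eb ea). Qed.
End Red2.
End StepContaining.

(** The empty default expresses that a leaf with several edges involving [e] gains no removable
    edge. *)
Definition sole H e F : ngraph G :=
  if #|` containing H e F| == 1 then containing H e F else fset0.

(* The list pairs the full dimensional leaves, in depth-first order, with their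
   sets of removable edges. *)
Inductive shelled : ngraph G -> tree G -> seq (ngraph G * ngraph G) -> Prop :=
| ShLeaf H : irreducible_graph H -> shelled H (Leaf H) [:: (H, fset0)]
| ShNode H a b T1 T3 T2 s1 s3 s2 : step H a b ->
    shelled (red1 H a b) T1 s1 -> shelled (red3 H a b) T3 s3 ->
    shelled (red2 H a b) T2 s2 ->
    shelled H (Node H T1 T3 T2)
      (s1 ++ [seq (p.1, p.2 `|` sole (red2 H a b) b p.1) | p <- s2]).

Lemma shelled_exists H T : reduction_tree (order_O le_in le_out) H T ->
  exists s, shelled H T s.
Proof.
elim=> {H T} [H iH|H a b T1 T3 T2 aH bH ab o _ [s1 S1] _ [s3 S3] _ [s2 S2]].
  by exists [:: (H, fset0)]; apply: ShLeaf.
by eexists; apply: ShNode S1 S3 S2.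
Qed.

Lemma shelled_step H T s a b : shelled H T s -> step H a b ->
  exists T1 T3 T2 s1 s3 s2,
    [/\ shelled (red1 H a b) T1 s1, shelled (red3 H a b) T3 s3,
        shelled (red2 H a b) T2 s2, T = Node H T1 T3 T2
      & s = s1 ++ [seq (p.1, p.2 `|` sole (red2 H a b) b p.1) | p <- s2]].
Proof.
case=> {H T s} [H iH|H a' b' T1 T3 T2 s1 s3 s2 st' S1 S3 S2] st.
  by case: st => aH bH ab _; have := iH a b aH bH; rewrite ab.
by have [-> ->] := step_fun hin hout st st'; exists T1, T3, T2, s1, s3, s2.
Qed.

Lemma shelled_case H T s : shelled H T s ->
  [/\ irreducible_graph H, T = Leaf H & s = [:: (H, fset0)]]
  \/ exists a b, step H a b.
Proof. by case=> {H T s} [H|H a b]; [left|right; exists a, b]. Qed.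

(** A measure for the inductions that descend two levels of the tree at once. *)
Fixpoint tree_size T : nat :=
  if T is Node _ T1 T3 T2 then (tree_size T1 + tree_size T3 + tree_size T2).+1 else 0.

Lemma in_shelling a b H s1 s2 p :
  p \in s1 ++ [seq (q.1, q.2 `|` sole (red2 H a b) b q.1) | q <- s2] ->
  p \in s1 \/ exists2 q, q \in s2 & p = (q.1, q.2 `|` sole (red2 H a b) b q.1).
Proof. by rewrite mem_cat => /orP[|/mapP]; [left|right]. Qed.

Lemma shelled_cone H T s : shelled H T s -> good H ->
  forall p, p \in s -> forall y, y \in p.1 -> cone H y.
Proof.
elim=> {H T s} [H iH _ p|H a b T1 T3 T2 s1 s3 s2 st _ IH1 _ _ _ IH2 gH p].
  by rewrite inE => /eqP-> y; apply: cone_mem.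
case/in_shelling=> [ps1|[q qs2 ->]] y yp.
  apply: (cone_red1 gH st); exact: (IH1 (good_red1 gH st) p).
apply: (cone_red2 gH st); exact: (IH2 (good_red2 gH st) q).
Qed.

Lemma shelled_card H T s : shelled H T s -> good H ->
  forall p, p \in s -> #|` p.1| = #|` H|.
Proof.
elim=> {H T s} [H iH _ p|H a b T1 T3 T2 s1 s3 s2 st _ IH1 _ _ _ IH2 gH p].
  by rewrite inE => /eqP->.
case/in_shelling=> [ps1|[q qs2 ->]] /=.
  by rewrite (IH1 (good_red1 gH st)) // (card_red1 gH st).
by rewrite (IH2 (good_red2 gH st)) // (card_red2 gH st).
Qed.

(** Hall's condition between the edges of a node and those of a leaf. It passes up the tree because
    each reduction turns [S] into a set of the same size with no larger neighbourhood. It is applied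
    to sets of one and two edges. *)
Lemma shelled_meeting H T s : shelled H T s -> good H ->
  forall p, p \in s -> forall S, S `<=` H -> (#|` S| <= #|` meeting H S p.1|)%N.
Proof.
move=> sh; elim: sh {-2}(sh) => {H T s}
  [H iH _ gH p|H a b T1 T3 T2 s1 s3 s2 st S1 IH1 _ _ S2 IH2 _ gH p].
  have [indH _] := gH; rewrite inE => /eqP-> S SH; apply/fsubset_leq_card/fsubsetP => h hS.
  have hH := fsubsetP SH _ hS.
  by rewrite !inE hH; apply/hasP; exists h => //; rewrite coef_mem ?eqxx.
case/in_shelling=> [ps1|[q qs2 ->]] S SH /=.
  have [S' [S'H <- sub]] := meeting_red1 gH st SH.
  apply: leq_trans (fsubset_leq_card (sub _ _)); first exact: (IH1 S1 (good_red1 gH st)).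
  exact: (shelled_cone S1 (good_red1 gH st)).
have [S' [S'H <- sub]] := meeting_red2 gH st SH.
apply: leq_trans (fsubset_leq_card (sub _ _)); first exact: (IH2 S2 (good_red2 gH st)).
exact: (shelled_cone S2 (good_red2 gH st)).
Qed.

Lemma containing_gt0 H T s p e : shelled H T s -> good H -> p \in s -> e \in H ->
  (0 < #|` containing H e p.1|)%N.
Proof.
move=> sh gH ps eH; have := shelled_meeting sh gH ps (S := [fset e]).
rewrite fsub1set cardfs1 => /(_ eH) h; apply: leq_trans h (fsubset_leq_card _).
apply/fsubsetP => y; rewrite !inE => /andP[-> /hasP[h]].
by rewrite inE => /eqP->.
Qed.

Lemma containing2_gt1 H T s p e f : shelled H T s -> good H -> p \in s ->
  e \in H -> f \in H -> e != f ->
  (1 < #|` containing H e p.1 `|` containing H f p.1|)%N.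
Proof.
move=> sh gH ps eH fH ef; have := shelled_meeting sh gH ps (S := [fset e; f]).
rewrite fsubUset !fsub1set cardfs2 eH fH ef => /(_ isT) h.
apply: leq_trans h (fsubset_leq_card _).
apply/fsubsetP => y; rewrite !inE => /andP[-> /hasP[h]].
by rewrite in_fset2 => /orP[/eqP->|/eqP->] -> //; rewrite orbT.
Qed.

(** Two edges of [H] are involved by at least two edges of the leaf, so two singletons cannot
    coincide. *)
Lemma sole_disjoint H T s p e f : shelled H T s -> good H -> p \in s ->
  e \in H -> f \in H -> e != f -> #|` containing H e p.1| = 1 ->
  sole H f p.1 `&` containing H e p.1 = fset0.
Proof.
move=> sh gH ps eH fH ef e1; rewrite /sole; case: eqP => [f1|_]; last exact: fset0I.
have := containing2_gt1 sh gH ps eH fH ef; rewrite fsetUC.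
have := cardfsUI (containing H f p.1) (containing H e p.1).
by rewrite e1 f1 => eq2 gt1; apply: cardfs0_eq; lia.
Qed.

(** If one edge alone involves [e], the edge gained for [f] is a different one; otherwise [X]
    already meets the edges involving [e]. *)
Lemma removable_sole H T s p e f (X : ngraph G) : shelled H T s -> good H -> p \in s ->
  e \in H -> f \in H -> e != f ->
  (X `&` containing H e p.1 != fset0) = (1 < #|` containing H e p.1|)%N ->
  ((X `|` sole H f p.1) `&` containing H e p.1 != fset0)
    = (1 < #|` containing H e p.1|)%N.
Proof.
move=> sh gH ps eH fH ef; rewrite fsetIUl; case: (ltnP 1 #|` containing H e p.1|) => h.
  by apply: fsubset_neq0; apply: fsubsetUl.
have e1 : #|` containing H e p.1| = 1.
  by apply/eqP; rewrite eqn_leq h (containing_gt0 sh gH ps eH).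
by move/negbFE/eqP=> ->; rewrite fset0U (sole_disjoint sh gH ps eH fH ef e1) eqxx.
Qed.

Lemma removable_mono (X Y X' Y' : ngraph G) : X `<=` X' -> Y `<=` Y' ->
  X `&` Y != fset0 -> X' `&` Y' != fset0.
Proof. by move=> XX YY; apply: fsubset_neq0; apply: fsetISS. Qed.

Lemma sole_neq0 H T s p e : shelled H T s -> good H -> p \in s -> e \in H ->
  #|` containing H e p.1| = 1 -> sole H e p.1 `&` containing H e p.1 != fset0.
Proof.
move=> sh gH ps eH e1; rewrite /sole e1 eqxx fsetIid -cardfs_gt0.
exact: containing_gt0 sh gH ps eH.
Qed.

(** Left leaves inherit the criterion from [e], or from the new edge if [e] is [b]. On the right, a
    still protected [e] is unaffected by the edge gained for [b]; if protection is lost, the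
    criterion comes from [e + b] one level further down. *)
Lemma removableE_rec k H T s : (tree_size T < k)%N -> shelled H T s -> good H ->
  forall e e', e \in H -> protects H e' e -> forall p, p \in s ->
  (p.2 `&` containing H e p.1 != fset0) = (1 < #|` containing H e p.1|)%N.
Proof.
elim: k H T s => // k IHk H T s; rewrite ltnS => leTk sh gH e e' eH pe p ps.
case: (shelled_case sh) => [[_ _ sE]|[a [b st]]].
  move: ps; rewrite sE inE => /eqP-> /=; have [iH _] := gH.
  by rewrite fset0I eqxx containing_self // cardfs1.
have [T1 [T3 [T2 [s1 [s3 [s2 [S1 S3 S2 TE sE]]]]]]] := shelled_step sh st.
have [lt1 lt2] : (tree_size T1 < k)%N /\ (tree_size T2 < k)%N.
  by move: leTk; rewrite TE; clear=> /= leTk; split; lia.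
have [aH bH _ _] := st; have g1 := good_red1 gH st; have g2 := good_red2 gH st.
set j := join_edge a b.
have b2 : b \in red2 H a b by rewrite mem_red2 eq_sym (step_neq gH st) bH.
have j2 : j \in red2 H a b by rewrite mem_red2 eqxx orbT.
have j1 : j \in red1 H a b by rewrite mem_red1 eqxx orbT.
have ea : e != a by apply: contraPneq pe => ->; exact: (not_protects_fst hin gH st).
have pb := protects_join hin gH st.
move: ps; rewrite sE => /in_shelling[ps1|[q qs2 ->]] /=.
  have c1 := shelled_cone S1 g1 ps1.
  case: (e =P b) => [eb|/eqP eb].
    rewrite eb (containing_red1_snd gH st c1) in pe *.
    by apply: (IHk _ _ _ lt1 S1 g1 _ _ j1 _ _ ps1); exact: (protects_red1_join gH st pe).
  rewrite (containing_red1 gH st c1 eH ea eb).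
  have [e'' pe''] := protected_red1 hin gH st eH eb pe.
  by apply: (IHk _ _ _ lt1 S1 g1 _ e'' _ pe'' _ ps1); rewrite mem_red1 eb eH.
have c2 := shelled_cone S2 g2 qs2.
(* In a right leaf with [e = b], both [b] and [j] contribute, so at least two edges involve [b]. One
   is removable: just gained if it alone involves [b] over the child, and by induction through [pb]
   otherwise. *)
case: (e =P b) => [eb|/eqP eb].
  have sub : containing (red2 H a b) b q.1 `<=` containing H e q.1.
    by rewrite eb (containing_red2_snd gH st c2) fsubsetUl.
  have bj : b != j by exact: (join_neq gH st bH).
  have -> : (1 < #|` containing H e q.1|)%N.
    rewrite eb (containing_red2_snd gH st c2).
    exact: (containing2_gt1 S2 g2 qs2 b2 j2 bj).
  case: (leqP #|` containing (red2 H a b) b q.1| 1) => hb.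
    have b1 : #|` containing (red2 H a b) b q.1| = 1.
      by apply/eqP; rewrite eqn_leq hb (containing_gt0 S2 g2 qs2 b2).
    exact: removable_mono (fsubsetUr _ _) sub (sole_neq0 S2 g2 qs2 b2 b1).
  move: hb; rewrite -(IHk _ _ _ lt2 S2 g2 _ _ b2 pb _ qs2).
  exact: removable_mono (fsubsetUl _ _) sub.
have e2 : e \in red2 H a b by rewrite mem_red2 ea eH.
rewrite (containing_red2 gH st c2 eH ea eb).
case: (protected_red2 hin gH st eH ea eb pe) => [[e'' pe'']|[st2 p1 p2]].
  apply: (removable_sole S2 g2 qs2 e2 b2 eb).
  exact: (IHk _ _ _ lt2 S2 g2 _ _ e2 pe'' _ qs2).
have [T21 [T23 [T22 [s21 [s23 [s22 [S21 S23 S22 T2E s2E]]]]]]] := shelled_step S2 st2.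
have [lt21 lt22] : (tree_size T21 < k)%N /\ (tree_size T22 < k)%N.
  by move: lt2; rewrite T2E; clear=> /= lt2; split; lia.
have g21 := good_red1 g2 st2; have g22 := good_red2 g2 st2.
set i := join_edge e b.
have i1 : i \in red1 (red2 H a b) e b by rewrite mem_red1 eqxx orbT.
have i2 : i \in red2 (red2 H a b) e b by rewrite mem_red2 eqxx orbT.
have be := step_neq g2 st2.
move: (qs2); rewrite s2E => /in_shelling[qs21|[r rs22 qE]].
  have c21 := shelled_cone S21 g21 qs21.
  have e21 : e \in red1 (red2 H a b) e b by rewrite mem_red1 be e2.
  (* Here [b] has been replaced by [i], the sum of [e] and [b], so the edges involving [b] also
     involve [e]. *)
  have sub : containing (red2 H a b) b q.1 `<=` containing (red2 H a b) e q.1.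
    by rewrite (containing_red1_snd g2 st2 c21) (containing_red1_fst g2 st2 c21) fsubsetUr.
  have -> : (1 < #|` containing (red2 H a b) e q.1|)%N.
    rewrite (containing_red1_fst g2 st2 c21).
    exact: (containing2_gt1 S21 g21 qs21 e21 i1 (join_neq g2 st2 e2)).
  case: (leqP #|` containing (red2 H a b) b q.1| 1) => hb.
    have b1 : #|` containing (red2 H a b) b q.1| = 1.
      by apply/eqP; rewrite eqn_leq hb (containing_gt0 S2 g2 qs2 b2).
    exact: removable_mono (fsubsetUr _ _) sub (sole_neq0 S2 g2 qs2 b2 b1).
  move: hb; rewrite {1}(containing_red1_snd g2 st2 c21).
  rewrite -(IHk _ _ _ lt21 S21 g21 _ _ i1 p1 _ qs21).
  apply: removable_mono (fsubsetUl _ _) _.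
  by rewrite -(containing_red1_snd g2 st2 c21).
have c22 := shelled_cone S22 g22 rs22.
have b22 : b \in red2 (red2 H a b) e b by rewrite mem_red2 eq_sym be b2.
have q1E : q.1 = r.1 by rewrite qE.
(* In this grandchild [b] is kept beside [i], so at least two edges involve [b] and none is
   gained. *)
have -> : sole (red2 H a b) b q.1 = fset0.
  rewrite /sole q1E (containing_red2_snd g2 st2 c22).
  have := containing2_gt1 S22 g22 rs22 b22 i2 (join_neq g2 st2 b2).
  by case: eqP => // ->.
rewrite q1E (containing_red2_fst g2 st2 c22) fsetU0 qE.
apply: (removable_sole S22 g22 rs22 i2 b22).
  by rewrite eq_sym (join_neq g2 st2).
exact: (IHk _ _ _ lt22 S22 g22 _ _ i2 p2 _ rs22).
Qed.

Lemma removableE H T s e e' p : shelled H T s -> good H ->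
  e \in H -> protects H e' e -> p \in s ->
  (p.2 `&` containing H e p.1 != fset0) = (1 < #|` containing H e p.1|)%N.
Proof. move=> sh gH eH pe; exact: (removableE_rec (ltnSn _) sh gH eH pe). Qed.

(** * Deleting an edge from a node *)

Implicit Types f g : ngraph G * ngraph G -> ngraph G.

(** The predicted list for [H] without [e]. The second component is left as a parameter because
    removable sets change form between a node and its children. *)
Definition del_with f H e s :=
  [seq (p.1 `\` containing H e p.1, f p) | p <- s & #|` containing H e p.1| == 1].

Local Notation del_shelling := (del_with snd).

Lemma del_with_cat f H e s1 s2 :
  del_with f H e (s1 ++ s2) = del_with f H e s1 ++ del_with f H e s2.
Proof. by rewrite /del_with filter_cat map_cat. Qed.

Lemma eq_del_with f g H K e d s :
  (forall p, p \in s -> containing H e p.1 = containing K d p.1) ->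
  (forall p, p \in s -> #|` containing K d p.1| = 1 -> f p = g p) ->
  del_with f H e s = del_with g K d s.
Proof.
move=> eqE fg; rewrite /del_with.
rewrite (eq_in_filter (a2 := fun p => #|` containing K d p.1| == 1)); last first.
  by move=> p /eqE->.
by apply/eq_in_map => p; rewrite mem_filter => /andP[/eqP p1 ps]; rewrite eqE ?fg.
Qed.

Lemma del_with_nil f H e s :
  (forall p, p \in s -> (1 < #|` containing H e p.1|)%N) -> del_with f H e s = [::].
Proof.
move=> gt1; rewrite /del_with.
case E: (filter _ s) => [//|p t]; have : p \in p :: t by rewrite inE eqxx.
by rewrite -E mem_filter => /andP[/eqP p1 /gt1]; rewrite p1.
Qed.

Lemma del_with_map f g H e s :
  del_with g H e [seq (p.1, f p) | p <- s] = del_with (fun p => g (p.1, f p)) H e s.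
Proof. by rewrite /del_with filter_map -map_comp. Qed.

Lemma map_del_with f g H e s :
  [seq (p.1, f p) | p <- del_with g H e s]
    = del_with (fun p => f (p.1 `\` containing H e p.1, g p)) H e s.
Proof. by rewrite /del_with -map_comp. Qed.

Lemma map_fst_del_with f g H e s :
  map fst (del_with f H e s) = map fst (del_with g H e s).
Proof. by rewrite /del_with -!map_comp. Qed.

Lemma del_shelling1 H e p : #|` containing H e p.1| = 1 ->
  del_shelling H e [:: p] = [:: (p.1 `\` containing H e p.1, p.2)].
Proof.
move=> p1; rewrite /del_with.
by rewrite -[filter _ _]/(if #|` containing H e p.1| == 1 then [:: p] else [::]) p1.
Qed.

Lemma shelled_leaf_del H e T' s' : good H -> e \in H -> irreducible_graph H ->
  shelled (H `\ e) T' s' -> s' = del_shelling H e [:: (H, fset0)].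
Proof.
move=> [iH _] eH irH sh'; case: (shelled_case sh') => [[_ _ ->]|[a [b [aH bH ab _]]]].
  by rewrite del_shelling1 containing_self // cardfs1.
by move: aH bH; rewrite !in_fsetD1 => /andP[_ aH] /andP[_ bH]; have := irH a b aH bH; rewrite ab.
Qed.

Section Deletion.
Variables (H : ngraph G) (a b : nedge G) (s1 s2 : seq (ngraph G * ngraph G)).
Variables (T1 T2 : tree G).
Hypotheses (gH : good H) (st : step H a b).
Hypotheses (S1 : shelled (red1 H a b) T1 s1) (S2 : shelled (red2 H a b) T2 s2).
Let g1 := good_red1 gH st.
Let g2 := good_red2 gH st.

(** Below [red1], both [a] and the new edge contribute to [a], so no leaf has a single edge
    involving it. *)
Lemma del_red1_fst f : del_with f H a s1 = [::].
Proof.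
apply: del_with_nil => p ps1.
have [aH bH _ _] := st; rewrite (containing_red1_fst gH st (shelled_cone S1 g1 ps1)).
apply: (containing2_gt1 S1 g1 ps1); last exact: (join_neq gH st aH).
  by rewrite mem_red1 (step_neq gH st) aH.
by rewrite mem_red1 eqxx orbT.
Qed.

Lemma del_red1_snd f : del_with f H b s1 = del_with f (red1 H a b) (join_edge a b) s1.
Proof.
by apply: eq_del_with => // p ps1; exact: (containing_red1_snd gH st (shelled_cone S1 g1 ps1)).
Qed.

Lemma del_red1 f e : e \in H -> e != a -> e != b ->
  del_with f H e s1 = del_with f (red1 H a b) e s1.
Proof.
move=> eH ea eb; apply: eq_del_with => // p ps1.
exact: (containing_red1 gH st (shelled_cone S1 g1 ps1)).
Qed.

Lemma containing_red2_snd_gt1 p : p \in s2 -> (1 < #|` containing H b p.1|)%N.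
Proof.
move=> ps2.
have [aH bH _ _] := st; rewrite (containing_red2_snd gH st (shelled_cone S2 g2 ps2)).
apply: (containing2_gt1 S2 g2 ps2); last exact: (join_neq gH st bH).
  by rewrite mem_red2 eq_sym (step_neq gH st) bH.
by rewrite mem_red2 eqxx orbT.
Qed.

Lemma del_red2_snd f : del_with f H b s2 = [::].
Proof. by apply: del_with_nil => p; exact: containing_red2_snd_gt1. Qed.

Lemma del_red2_fst f : del_with f H a s2 = del_with f (red2 H a b) (join_edge a b) s2.
Proof.
by apply: eq_del_with => // p ps2; exact: (containing_red2_fst gH st (shelled_cone S2 g2 ps2)).
Qed.

Lemma del_red2 f e : e \in H -> e != a -> e != b ->
  del_with f H e s2 = del_with f (red2 H a b) e s2.
Proof.
move=> eH ea eb; apply: eq_del_with => // p ps2.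
exact: (containing_red2 gH st (shelled_cone S2 g2 ps2)).
Qed.

End Deletion.

(** If [e] is [a] or [b], only one child contributes, and deleting the new edge from that child
    gives the same graph. Otherwise [H] without [e] is reduced on the same pair. *)
Lemma del_fst H T s e T' s' : shelled H T s -> good H -> e \in H ->
  shelled (H `\ e) T' s' -> map fst s' = map fst (del_shelling H e s).
Proof.
move=> sh; elim: sh {-2}(sh) e T' s' => {H T s}.
  by move=> H irH _ e T' s' gH eH /(shelled_leaf_del gH eH irH)->.
move=> H a b T1 T3 T2 s1 s3 s2 st S1 IH1 _ _ S2 IH2 _ e T' s' gH eH sh'.
have g1 := good_red1 gH st; have g2 := good_red2 gH st.
rewrite del_with_cat map_cat del_with_map (map_fst_del_with _ snd _ _ s2).
case: (e =P a) => [ea|/eqP ea].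
  subst e; rewrite (del_red1_fst gH st S1) (del_red2_fst gH st S2) /=.
  apply: (IH2 S2 _ T' s' g2); first by rewrite mem_red2 eqxx orbT.
  by rewrite (red2_join gH st); exact: sh'.
case: (e =P b) => [eb|/eqP eb].
  subst e; rewrite (del_red1_snd gH st S1) (del_red2_snd gH st S2) cats0.
  apply: (IH1 S1 _ T' s' g1); first by rewrite mem_red1 eqxx orbT.
  by rewrite (red1_join gH st); exact: sh'.
have st' : step (H `\ e) a b by apply: step_del; rewrite // eq_sym.
have [T1' [T3' [T2' [s1' [s3' [s2' [S1' _ S2' _ ->]]]]]]] := shelled_step sh' st'.
rewrite map_cat -map_comp (del_red1 gH st S1) // (del_red2 gH st S2) //.
rewrite (red1_del gH st eH) in S1'; rewrite (red2_del gH st eH) in S2'.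
rewrite (IH1 S1 e _ _ g1 _ S1'); last by rewrite mem_red1 eb eH.
by rewrite -(IH2 S2 e _ _ g2 _ S2') // mem_red2 ea eH.
Qed.

(* By [removableE], whether [d] lies in a single edge of a leaf can be read off its
   removable edges, which are the same before and after the deletion of [e]. *)
Lemma sole_del H T s e (d e' d' : nedge G) T' p : shelled H T s -> good H -> e \in H -> d \in H ->
  e != d -> protects H e' e -> protects H d' d -> d' != e ->
  shelled (H `\ e) T' (del_shelling H e s) -> p \in s -> #|` containing H e p.1| = 1 ->
  sole (H `\ e) d (p.1 `\` containing H e p.1) = sole H d p.1.
Proof.
move=> sh gH eH fH ef pe pf d'e sh' ps p1.
have ps' : (p.1 `\` containing H e p.1, p.2) \in del_shelling H e s.
  by apply/mapP; exists p; rewrite // mem_filter p1 eqxx ps.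
have g' := good_del eH gH.
have fH' : d \in H `\ e by rewrite in_fsetD1 eq_sym ef fH.
have := removableE sh' g' fH' (protects_del d'e pf) ps'.
have := removableE sh gH fH pf ps.
have := removableE sh gH eH pe ps; rewrite p1 /= => /negbFE/eqP p2e.
have [iH _] := gH.
have fE : containing (H `\ e) d (p.1 `\` containing H e p.1)
          = containing H d p.1 `\` containing H e p.1.
  rewrite (eq_containing (K := H) (f := d)); first exact: fset_sepD.
  by move=> y yF; apply: (coef_del iH eH _ fH'); exact: (shelled_cone sh' g' ps').
rewrite /= fE.
rewrite (fsetI_disjD _ p2e).
move=> -> eq1.
have := containing_gt0 sh' g' ps' fH'; rewrite /= fE.
have := containing_gt0 sh gH ps fH.
rewrite /sole fE; move: eq1.
have : containing H d p.1 `\` containing H e p.1 `<=` containing H d p.1 by exact: fsubsetDl.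
move: (containing H d p.1) (_ `\` _) => A B BA eq1 A0 B0.
case: (#|`A| =P 1) => A1; case: (#|` B| =P 1) => B1 //.
- by apply/eqP; rewrite eqEfcard BA A1 B1.
- by case: B1; apply/eqP; rewrite eqn_leq B0 andbT leqNgt -eq1 A1.
- by case: A1; apply/eqP; rewrite eqn_leq A0 andbT leqNgt eq1 B1.
Qed.

(** Protection excludes [e = a], and [e = b] becomes the new edge of the left child. Otherwise both
    trees take the same step, and [sole_del] matches the edges gained on the right. *)
Lemma del_shelled_rec k H T s e e' T' s' : (tree_size T < k)%N ->
  shelled H T s -> good H -> e \in H -> protects H e' e ->
  shelled (H `\ e) T' s' -> s' = del_shelling H e s.
Proof.
elim: k H T s e e' T' s' => // k IHk H T s e e' T' s'; rewrite ltnS => leTk sh gH eH pe sh'.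
case: (shelled_case sh) => [[irH _ sE]|[a [b st]]].
  by rewrite sE; exact: (shelled_leaf_del gH eH irH sh').
have [T1 [T3 [T2 [s1 [s3 [s2 [S1 S3 S2 TE sE]]]]]]] := shelled_step sh st.
have [lt1 lt2] : (tree_size T1 < k)%N /\ (tree_size T2 < k)%N.
  by move: leTk; rewrite TE; clear=> /= leTk; split; lia.
have [aH bH _ _] := st; have g1 := good_red1 gH st; have g2 := good_red2 gH st.
set j := join_edge a b.
have b2 : b \in red2 H a b by rewrite mem_red2 eq_sym (step_neq gH st) bH.
have j2 : j \in red2 H a b by rewrite mem_red2 eqxx orbT.
have j1 : j \in red1 H a b by rewrite mem_red1 eqxx orbT.
have ea : e != a by apply: contraPneq pe => ->; exact: (not_protects_fst hin gH st).
have pb := protects_join hin gH st.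
rewrite sE del_with_cat.
case: (e =P b) => [eb|/eqP eb].
  subst e; rewrite (del_red1_snd gH st S1).
  rewrite del_with_map (del_red2_snd gH st S2) cats0.
  rewrite -(red1_join gH st) in sh'.
  exact: (IHk _ _ _ _ _ _ _ lt1 S1 g1 j1 (protects_red1_join gH st pe) sh').
have st' : step (H `\ e) a b by apply: step_del; rewrite // eq_sym.
have [T1' [T3' [T2' [s1' [s3' [s2' [S1' _ S2' _ ->]]]]]]] := shelled_step sh' st'.
rewrite (red1_del gH st eH) in S1'; rewrite (red2_del gH st eH) in S2' *.
have e1 : e \in red1 H a b by rewrite mem_red1 eb eH.
have e2 : e \in red2 H a b by rewrite mem_red2 ea eH.
have [e'' pe''] := protected_red1 hin gH st eH eb pe.
congr (_ ++ _).
  by rewrite (IHk _ _ _ _ _ _ _ lt1 S1 g1 e1 pe'' S1') (del_red1 gH st S1).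
rewrite del_with_map.
case: (protected_red2 hin gH st eH ea eb pe) => [[f pf]|[st2 p1 p2]].
  have s2E := IHk _ _ _ _ _ _ _ lt2 S2 g2 e2 pf S2'.
  rewrite s2E in S2' *; rewrite map_del_with (del_red2 gH st S2) //.
  apply: eq_del_with => // p ps2 p1.
  have je : j != e by rewrite eq_sym (join_neq gH st).
  by rewrite (sole_del S2 g2 e2 b2 eb pf pb je S2' ps2 p1).
have [T21 [T23 [T22 [s21 [s23 [s22 [S21 S23 S22 T2E s2E]]]]]]] := shelled_step S2 st2.
have lt22 : (tree_size T22 < k)%N by move: lt2; rewrite T2E; clear=> /= lt2; lia.
have g22 := good_red2 g2 st2.
set i := join_edge e b.
have ji : j != i := join_neq g2 st2 j2.
have i2 : i \in red2 (red2 H a b) e b by rewrite mem_red2 eqxx orbT.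
have be := step_neq g2 st2.
have b22 : b \in red2 (red2 H a b) e b by rewrite mem_red2 eq_sym be b2.
(* Protection of [e] is lost and [e] is the next in-edge, so deleting it amounts to deleting the
   protected edge [i] from the right grandchild. *)
rewrite -(red2_join g2 st2) in S2' *.
have s2'E := IHk _ _ _ _ _ _ _ lt22 S22 g22 i2 p2 S2'.
rewrite s2'E in S2' *.
rewrite (del_red2 gH st S2) // s2E del_with_cat (del_red1_fst g2 st2 S21).
rewrite del_with_map map_del_with (del_red2_fst g2 st2 S22).
apply: eq_del_with => // p ps22 pE /=.
have -> : sole (red2 H a b) b p.1 = fset0.
  have := containing_red2_snd_gt1 g2 st2 S22 ps22.
  by rewrite /sole; case: eqP => // ->.
have bi : i != b by rewrite eq_sym (join_neq g2 st2).
have je : j != e by rewrite eq_sym (join_neq gH st).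
have pb22 := protects_red2 g2 st2 b2 je pb.
rewrite fsetU0 (sole_del S22 g22 i2 b22 bi p2 _ ji S2' ps22 pE) //.
Qed.

Lemma del_shelled H T s e e' T' s' :
  shelled H T s -> good H -> e \in H -> protects H e' e ->
  shelled (H `\ e) T' s' -> s' = del_shelling H e s.
Proof. exact: del_shelled_rec (ltnSn _). Qed.

(** * Leaves and facets read off the shelling *)

(** Every right leaf has an edge involving [b] over [red2], and such an edge occurs in no left
    leaf. *)
Lemma shelled_uniq H T s : shelled H T s -> good H -> uniq (map fst s).
Proof.
move=> sh; elim: sh => {H T s} [//|H a b T1 T3 T2 s1 s3 s2 st S1 IH1 _ _ S2 IH2 gH].
have g1 := good_red1 gH st; have g2 := good_red2 gH st.
rewrite map_cat -map_comp cat_uniq IH1 //= IH2 // andbT.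
apply/hasPn => F /mapP[p ps2 ->]; apply/negP => /mapP[q qs1 pq].
have b2 : b \in red2 H a b.
  by have [_ bH _ _] := st; rewrite mem_red2 eq_sym (step_neq gH st) bH.
have := containing_gt0 S2 g2 ps2 b2; rewrite cardfs_gt0 => /fset0Pn[y].
rewrite in_containing => /andP[yp].
have yq : y \in q.1 by rewrite -pq.
by have [_ ->] := coef_red2_both gH st (shelled_cone S1 g1 qs1 yq) (shelled_cone S2 g2 ps2 yp).
Qed.

Lemma leaves_card H T s : shelled H T s -> good H ->
  forall L, L \in leaves T -> (#|` L| <= #|` H|)%N.
Proof.
elim=> {H T s} [H _ _ L|H a b T1 T3 T2 s1 s3 s2 st S1 IH1 _ IH3 S2 IH2 gH L].
  by rewrite inE => /eqP->.
have g1 := good_red1 gH st; have aH : a \in red1 H a b.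
  by have [aH _ _ _] := st; rewrite mem_red1 (step_neq gH st) aH.
have g3 : good (red3 H a b) by rewrite (red3_red1 gH st); apply: good_del.
rewrite !mem_cat => /or3P[/(IH1 g1)|/(IH3 g3)|/(IH2 (good_red2 gH st))].
- by rewrite (card_red1 gH st).
- by rewrite -(card_red3 gH st); apply: leqW.
- by rewrite (card_red2 gH st).
Qed.

Lemma full_leavesE H T s : shelled H T s -> good H ->
  [seq F <- leaves T | #|` F| == #|` H|] = map fst s.
Proof.
elim=> {H T s} [H _ _|H a b T1 T3 T2 s1 s3 s2 st S1 IH1 S3 _ S2 IH2 gH].
  by rewrite /= eqxx.
have g1 := good_red1 gH st; have aH : a \in red1 H a b.
  by have [aH _ _ _] := st; rewrite mem_red1 (step_neq gH st) aH.
have g3 : good (red3 H a b) by rewrite (red3_red1 gH st); apply: good_del.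
rewrite [leaves _]/= !filter_cat map_cat -map_comp.
rewrite -{1}(card_red1 gH st) IH1 // -[in X in _ ++ (_ ++ X)](card_red2 gH st) IH2; last first.
  exact: good_red2 gH st.
congr (_ ++ _); rewrite -[RHS]cat0s; congr (_ ++ _).
have none : {in leaves T3, (fun F : ngraph G => #|` F| == #|` H|) =1 pred0}.
  by move=> L /(leaves_card S3 g3); rewrite -(card_red3 gH st) -ltnS => /ltn_eqF.
by have := eq_in_filter none; rewrite filter_pred0.
Qed.

(** If [x] alone involves [e] and is not yet removable, adding it to the removable edges doubles the
    terms: the old ones, and those of the leaf without [x], which belong to the deletion of [e]. *)
Lemma caps_sole H e s :
  (forall p, p \in s -> #|` containing H e p.1| = 1 ->
     p.2 `&` containing H e p.1 = fset0) ->
  perm_eq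
    (flatten [seq caps p.1 (removals p.1 (p.2 `|` sole H e p.1)) | p <- s])
    (flatten [seq caps p.1 (removals p.1 p.2) | p <- del_shelling H e s]
     ++ flatten [seq caps p.1 (removals p.1 p.2) | p <- s]).
Proof.
elim: s => [//|p s IH] disj.
have {}IH := IH (fun q qs => disj q (@mem_behead _ (p :: s) q qs)).
have -> : del_shelling H e (p :: s) = del_shelling H e [:: p] ++ del_shelling H e s.
  by rewrite -del_with_cat.
rewrite map_cat flatten_cat.
have : perm_eq (caps p.1 (removals p.1 (p.2 `|` sole H e p.1)))
  (flatten [seq caps p.1 (removals p.1 p.2) | p <- del_shelling H e [:: p]]
     ++ caps p.1 (removals p.1 p.2)).
  case: (#|` containing H e p.1| =P 1) => p1; last first.
    rewrite /sole /del_with /=; case: eqP => //= _; by rewrite fsetU0.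
  rewrite del_shelling1 //= cats0 /sole p1 eqxx.
  have := disj p (mem_head _ _) p1.
  have := containing_sub H e p.1.
  have /cardfs1P[y ->] : #|` containing H e p.1| == 1 by apply/eqP.
  rewrite fsub1set => yp yd.
  have yN : y \notin p.2.
    apply/negP => yp2; have : y \in p.2 `&` [fset y] by rewrite in_fsetI yp2 in_fset1 eqxx.
    by rewrite yd in_fset0.
  have perm_y : perm_eq (p.2 `|` [fset y]) (y :: p.2).
    apply: uniq_perm; rewrite /= ?yN ?fset_uniq // => x.
    by rewrite in_fsetU in_fset1 inE orbC.
  apply: perm_trans (perm_caps _ (perm_map _ perm_y)) _ => /=.
  rewrite perm_catC fsetIDA fsetIid; apply: perm_cat => //.
  by rewrite (@caps_removals _ _ p.1 (p.1 `\ y)) // fsubD1set.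
move=> pp; apply: perm_trans (perm_cat pp IH) _.
rewrite -!catA perm_cat2l perm_catCA; exact: perm_refl.
Qed.

(** By [caps_sole], the terms gained by the right leaves are those of [red2] without [b], which is
    the middle child. *)
Lemma perm_leaves H T s : shelled H T s -> good H ->
  perm_eq (leaves T) (flatten [seq caps p.1 (removals p.1 p.2) | p <- s]).
Proof.
elim=> {H T s} [H _ _|H a b T1 T3 T2 s1 s3 s2 st S1 IH1 S3 IH3 S2 IH2 gH]; first by [].
have g1 := good_red1 gH st; have g2 := good_red2 gH st.
have [_ bH _ _] := st.
have b2 : b \in red2 H a b by rewrite mem_red2 eq_sym (step_neq gH st) bH.
have g3 : good (red3 H a b) by rewrite (red3_red2 gH st); apply: good_del.
rewrite [leaves _]/= map_cat flatten_cat -map_comp.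
apply: perm_cat (IH1 g1) _; rewrite perm_sym.
apply: perm_trans (caps_sole _) _.
  move=> p ps2 p1; have := removableE S2 g2 b2 (protects_join hin gH st) ps2.
  by rewrite p1 => /negbFE/eqP.
rewrite perm_sym; apply: perm_cat (IH2 g2).
rewrite (red3_red2 gH st) in S3.
by rewrite -(del_shelled S2 g2 b2 (protects_join hin gH st) S3); apply: IH3.
Qed.

(** A left leaf shares with [q.1] no edge involving [b] over [red2]. If [q.1] has several such edges
    there is no facet; if it has one, the only candidate is [q.1] without it, and it must be counted
    exactly once. *)
Lemma facets_left H a b T1 T3 T2 s1 s3 s2 q : good H -> step H a b ->
  shelled (red1 H a b) T1 s1 -> shelled (red3 H a b) T3 s3 ->
  shelled (red2 H a b) T2 s2 -> q \in s2 ->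
  perm_eq (facets_in q.1 (map fst s1) : seq (ngraph G)) (removals q.1 (sole (red2 H a b) b q.1)).
Proof.
move=> gH st S1 S3 S2 qs2.
have g1 := good_red1 gH st; have g2 := good_red2 gH st.
have [aH bH _ _] := st.
have b2 : b \in red2 H a b by rewrite mem_red2 eq_sym (step_neq gH st) bH.
have a1 : a \in red1 H a b by rewrite mem_red1 (step_neq gH st) aH.
have sub : {in map fst s1, forall F', q.1 `&` F' `<=` q.1 `\` containing (red2 H a b) b q.1}.
  move=> _ /mapP[p ps1 ->]; apply/fsubsetP => y; rewrite in_fsetI => /andP[yq yp].
  have [_ y0] := coef_red2_both gH st (shelled_cone S1 g1 ps1 yp) (shelled_cone S2 g2 qs2 yq).
  by rewrite in_fsetD yq andbT in_containing y0 andbF.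
case: (#|` containing (red2 H a b) b q.1| =P 1) => q1; last first.
  rewrite /sole; case: eqP => // _.
  rewrite (facets_in_nil _ (containing_sub _ _ _) sub) //.
  by have := containing_gt0 S2 g2 qs2 b2; case: (#|` _|) q1 => [|[|]].
set Q := q.1 `\` containing (red2 H a b) b q.1.
have cQ : #|` Q|.+1 = #|` q.1|.
  have := fsubset_leq_card (containing_sub (red2 H a b) b q.1).
  by rewrite /Q (cardfsDS (containing_sub _ _ _)) q1; lia.
rewrite (facets_in_nseq (fsubsetDl _ _) cQ sub).
have -> : removals q.1 (sole (red2 H a b) b q.1) = [:: Q].
  rewrite /sole q1 eqxx /Q.
  have /cardfs1P[y ->] : #|` containing (red2 H a b) b q.1| == 1 by apply/eqP.
  by rewrite /removals seq_of_fset1.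
(* Deleting [b] on the right shows [Q] to be a leaf of the middle child. Deleting [a] on the left
   yields the same leaves, and their distinctness leaves exactly one left leaf containing [Q]. *)
suff -> : count (fun F' => Q `<=` F') (map fst s1) = 1 by [].
rewrite (red3_red2 gH st) in S3; have Q3 := del_fst S2 g2 b2 S3.
rewrite -(red3_red2 gH st) (red3_red1 gH st) in S3; have Q1 := del_fst S1 g1 a1 S3.
have Qs3 : Q \in map fst s3.
  rewrite Q3 /del_with -map_comp; apply/mapP; exists q => //.
  by rewrite mem_filter q1 eqxx.
have u3 : uniq (map fst s3) by exact: shelled_uniq S3 (good_del a1 g1).
have := count_uniq_mem Q u3; rewrite Qs3 /= => <-.
rewrite Q1 /del_with -map_comp !count_map count_filter.
apply: eq_in_count => p ps1 /=.
have pq : #|` p.1| = #|` q.1|.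
  apply: etrans (etrans (shelled_card S1 g1 ps1) (card_red1 gH st)) _.
  exact: esym (etrans (shelled_card S2 g2 qs2) (card_red2 gH st)).
apply/idP/andP => [Qp|[/eqP <- _]]; last exact: fsubsetDl.
(* An edge shared with [q.1] cannot involve [a] over [red1], so the one edge of [p.1] outside [Q] is
   the one that does. *)
have sub1 : containing (red1 H a b) a p.1 `<=` p.1 `\` Q.
  apply/fsubsetP => y; rewrite in_containing in_fsetD => /andP[yp ya]; rewrite yp andbT.
  apply/negP => yQ; have yq := fsubsetP (fsubsetDl _ _) _ yQ.
  have [y0 _] := coef_red2_both gH st (shelled_cone S1 g1 ps1 yp) (shelled_cone S2 g2 qs2 yq).
  by rewrite y0 in ya.
have c1 : #|` p.1 `\` Q| = 1 by rewrite (cardfsDS Qp) pq -cQ subSnn.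
have /eqP E : containing (red1 H a b) a p.1 == p.1 `\` Q.
  by rewrite eqEfcard sub1 c1 (containing_gt0 S1 g1 ps1 a1).
by rewrite E c1 fsetDDr fsetDv fset0U eqxx; split=> //; apply/eqP/fsetIidPr.
Qed.

(** Before a right leaf come all left leaves, which give the edge gained through [sole], and the
    earlier right leaves, handled by induction. [removableE] makes the two contributions disjoint,
    so nothing is counted twice. *)
Lemma perm_facets H T s i p0 : shelled H T s -> good H -> (i < size s)%N ->
  perm_eq (facets_in (nth p0 s i).1 (take i (map fst s)) : seq (ngraph G))
          (removals (nth p0 s i).1 (nth p0 s i).2).
Proof.
move=> sh; elim: sh i => {H T s} [H _ [|] //=|].
move=> H a b T1 T3 T2 s1 s3 s2 st S1 IH1 S3 _ S2 IH2 i gH.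
have g1 := good_red1 gH st; have g2 := good_red2 gH st.
have [_ bH _ _] := st.
have b2 : b \in red2 H a b by rewrite mem_red2 eq_sym (step_neq gH st) bH.
rewrite size_cat size_map nth_cat map_cat take_cat size_map.
case: (ltnP i (size s1)) => [i1 _|i1 i2].
  exact: (IH1 i g1 i1).
have {}i2 : (i - size s1 < size s2)%N by rewrite ltn_subLR.
move: (i - size s1)%N i2 => k i2 {i i1}.
rewrite -map_comp (nth_map p0) // facets_in_cat.
rewrite [X in take k X](_ : _ = map fst s2); last by [].
have qs2 := mem_nth p0 i2; set q := nth p0 s2 k in qs2 *.
apply: perm_trans (perm_cat (facets_left gH st S1 S3 S2 qs2) (IH2 k g2 i2)) _.
rewrite -/q /removals -map_cat; apply: perm_map.
apply: uniq_perm; rewrite ?fset_uniq //; last first.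
  by move=> x; rewrite in_fsetU mem_cat orbC.
rewrite cat_uniq !fset_uniq andbT /=; apply/hasPn => x xq.
apply/negP; rewrite /sole; case: eqP => // q1 xc.
have := removableE S2 g2 b2 (protects_join hin gH st) qs2.
rewrite q1 => /negbFE/eqP E0.
have : x \in q.2 `&` containing (red2 H a b) b q.1 by rewrite in_fsetI xq xc.
by rewrite E0 in_fset0.
Qed.
End Shelling.

(** * Formal sums of graphs *)

Lemma perm_flatten_map (I : Type) (S : eqType) (f g : I -> seq S) (l : seq I) :
  perm_eq (flatten [seq f i ++ g i | i <- l])
          (flatten [seq f i | i <- l] ++ flatten [seq g i | i <- l]).
Proof.
elim: l => //= i l IH; rewrite -!catA perm_cat2l.
by apply: perm_trans (perm_cat (perm_refl _) IH) _; rewrite perm_catCA.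
Qed.

Lemma eq_perm_flatten (I S : eqType) (f g : I -> seq S) (l : seq I) :
  {in l, forall i, perm_eq (f i) (g i)} ->
  perm_eq (flatten [seq f i | i <- l]) (flatten [seq g i | i <- l]).
Proof.
elim: l => //= i l IH fg; apply: perm_cat; first by apply: fg; rewrite inE eqxx.
by apply: IH => j jl; apply: fg; rewrite inE jl orbT.
Qed.

Section Multigraph.
Variables (n : nat) (G : multigraph n).
Implicit Types (A F Q : ngraph G) (P s : seq (ngraph G)) (h : nedge G).

(** Every term lies in [F], which therefore acts as a unit. *)
Lemma perm_gmul F Q s : {in s, forall A, A `<=` F} ->
  perm_eq (gmul s [:: F; Q]) (s ++ [seq A `&` Q | A <- s]).
Proof.
move=> sF.
have -> : gmul s [:: F; Q] = flatten [seq [:: A] ++ [:: A `&` Q] | A <- s].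
  by congr flatten; apply/eq_in_map => A /sF/fsetIidPl /= ->.
apply: perm_trans (perm_flatten_map _ _ _) _.
by rewrite !flatten_map1 map_id.
Qed.

Lemma perm_foldl_gmul F P s : {in s, forall A, A `<=` F} ->
  perm_eq (foldl (fun t Q => gmul t [:: F; Q]) s P) (flatten [seq caps A P | A <- s]).
Proof.
elim: P s => [|Q P IH] s sF /=; first by rewrite flatten_map1 map_id.
have sQ := perm_gmul Q sF.
apply: perm_trans (IH _ _) _.
  move=> A; rewrite (perm_mem sQ) mem_cat => /orP[/sF//|/mapP[B /sF BF ->]].
  exact: fsubset_trans (fsubsetIl _ _) BF.
apply: perm_trans (perm_flatten (perm_map _ sQ)) _.
by rewrite map_cat flatten_cat -map_comp perm_sym perm_flatten_map.
Qed.

Lemma perm_gprod F P : {in P, forall Q, Q `<=` F} -> perm_eq (gprod F P) (caps F P).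
Proof.
case: P => [//|Q P] PF; have QF : Q `<=` F by apply: PF; rewrite inE eqxx.
apply: perm_trans (perm_foldl_gmul _ _) _.
  by move=> A; rewrite !inE => /orP[] /eqP->.
by rewrite /= cats0 (fsetIidPr QF).
Qed.

Lemma perm_enum_masks m : perm_eq [seq tval t | t <- enum {: m.-tuple bool}] (masks m).
Proof.
apply: uniq_perm; [|exact: masks_uniq|].
  by rewrite (map_inj_uniq val_inj) enum_uniq.
move=> t; rewrite mem_masks; apply/mapP/eqP => [[u _ ->]|tm]; first exact: size_tuple.
by exists (tcast tm (in_tuple t)); rewrite ?mem_enum ?val_tcast.
Qed.

(** The term [F] stands for the empty sub-multiset; on the others, starting the intersection from
    [F] changes nothing because all members lie in [F]. *)
Lemma perm_gcaps F P : {in P, forall Q, Q `<=` F} -> perm_eq (F :: gcaps P) (caps F P).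
Proof.
move=> PF; rewrite caps_masks perm_sym.
set c := fun m => foldl (@fsetI _) F (mask m P) : ngraph G.
apply: perm_trans (perm_map c _) _.
  by rewrite perm_sym; apply: perm_enum_masks.
pose has_true (m : bitseq) := true \in m.
have := perm_map c (introT permPl
  (perm_filterC has_true [seq tval t | t <- enum {: (size P).-tuple bool}])).
rewrite perm_sym => /perm_trans; apply; rewrite map_cat perm_catC.
have -> : filter (predC has_true) [seq tval t | t <- enum {: (size P).-tuple bool}]
          = [:: nseq (size P) false].
  apply: perm_small_eq => //; apply: uniq_perm => //.
    by rewrite filter_uniq // (perm_uniq (perm_enum_masks _)) masks_uniq.
  move=> m; rewrite mem_filter (perm_mem (perm_enum_masks _)) mem_masks mem_seq1.
  rewrite [predC _ _]/(~~ (true \in m)).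
  apply/andP/eqP => [[mt /eqP <-]|->]; last by rewrite size_nseq eqxx mem_nseq andbF.
  apply/all_pred1P/allP => b bm /=; case: b bm => // bm.
  by rewrite bm in mt.
rewrite /= {1}/c mask_false perm_cons filter_map -map_comp /gcaps.
set E := filter _ _.
suff /eq_in_map-> : {in E, c \o (fun t => tval t)
    =1 (fun t : (size P).-tuple bool => gcap (mask t P))} by [].
move=> t; rewrite mem_filter => /andP[mt _]; rewrite /= /c.
have : (0 < size (mask t P))%N.
  by rewrite size_mask ?size_tuple // -has_count; apply/hasP; exists true.
have sub : {in mask t P, forall Q, Q `<=` F} by move=> Q /mem_mask/PF.
case: (mask t P) sub => //= Q l sub _; congr foldl.
by apply/fsetIidPr/sub; rewrite inE eqxx.
Qed.

Let edge_of (e : edge G) : nedge G := (src e, tgt e, fsum1 e).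

Let edge_of_inj : injective edge_of.
Proof.
move=> e f [_ _ /ffunP/(_ e)]; rewrite !ffunE eqxx.
by case: eqP.
Qed.

Lemma card_root_graph : #|` root_graph G| = #|edge G|.
Proof. by rewrite (card_imfset _ _ edge_of_inj) /= -cardE. Qed.

(** The formal sums of the root edges are unit vectors, so evaluation at [e] reads off a
    coefficient. *)
Lemma good_root_graph : good (root_graph G).
Proof.
split; last by move=> _ /imfsetP[e _ ->]; apply: src_lt_tgt.
have combE m e : comb (root_graph G) m e = m (edge_of e).
  have eR : edge_of e \in root_graph G by apply/imfsetP; exists e.
  have evM (x : fsum G) k : (x *+ k)%R e = (x e * k)%N.
    by elim: k => [|k IH]; rewrite ?mulr0n ?muln0 ?mulrS ffunE // IH mulnS.
  have evD : {morph (fun x : fsum G => x e) : x y / (x + y)%R >-> (x + y)%N}.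
    by move=> x y; rewrite ffunE.
  have ev0 : (0 : fsum G)%R e = 0 by rewrite ffunE.
  rewrite (combD1 _ eR) evD evM /comb (big_morph _ evD ev0) big_seq big1.
    by rewrite addn0 /nsum /= ffunE eqxx mul1n.
  move=> h; rewrite in_fsetD1 => /andP[he /imfsetP[f _ hE]]; rewrite evM hE.
  rewrite /nsum /= ffunE; case: eqP => //= ef.
  by rewrite hE -ef eqxx in he.
move=> m m' /ffunP mm' _ /imfsetP[e _ ->].
by rewrite -!combE.
Qed.

End Multigraph.

Theorem theorem5 (n : nat) (G : multigraph n) (le_in le_out : rel (fsum G))
    (hin : tie_order le_in) (hout : tie_order le_out)
    (T : tree G) (hT : is_R_O le_in le_out T) :
  let Fs := full_leaves T in
  perm_eq
    (flatten [seq gprod (nth fset0 Fs i) (facets Fs i) | i <- iota 0 (size Fs)])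
    (leaves T)
  /\
  perm_eq
    (Fs ++ flatten [seq gcaps (facets Fs i) | i <- iota 0 (size Fs)])
    (leaves T).
Proof.
have gR := good_root_graph G; have [s sh] := shelled_exists hT.
have -> : full_leaves T = map fst s.
  by rewrite -(full_leavesE sh gR) card_root_graph.
move=> Fs; pose p0 : ngraph G * ngraph G := (fset0, fset0).
have FE i : (i < size Fs)%N -> nth fset0 Fs i = (nth p0 s i).1.
  by rewrite size_map => ltis; rewrite (nth_map p0).
have PE i : (i < size Fs)%N ->
    perm_eq (facets Fs i) (removals (nth p0 s i).1 (nth p0 s i).2).
  move=> ltiF; have ltis : (i < size s)%N by rewrite -(size_map fst).
  by have := perm_facets hin hout p0 sh gR ltis; rewrite -FE.
have PF i : (i < size Fs)%N -> {in facets Fs i, forall Q, Q `<=` nth fset0 Fs i}.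
  by move=> _ Q; rewrite mem_filter => /andP[_ /mapP[F' _ ->]]; apply: fsubsetIl.
(* Both sums of the theorem agree leaf by leaf with [caps], so only this form is compared with the
   leaves. *)
have capsE : perm_eq
    (flatten [seq caps (nth fset0 Fs i) (facets Fs i) | i <- iota 0 (size Fs)])
    (leaves T).
  rewrite perm_sym; apply: perm_trans (perm_leaves hin hout sh gR) _.
  rewrite -[in X in perm_eq X](mkseq_nth p0 s) -map_comp perm_sym size_map.
  apply: eq_perm_flatten => i; rewrite mem_iota add0n => ltis.
  have ltiF : (i < size Fs)%N by rewrite size_map.
  by rewrite /= -FE //; apply: perm_caps; rewrite FE //; apply: PE.
split; apply: perm_trans capsE.
  apply: eq_perm_flatten => i; rewrite mem_iota add0n => ltiF.
  exact/perm_gprod/PF.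
have FsE : Fs = flatten [seq [:: nth fset0 Fs i] | i <- iota 0 (size Fs)].
  by rewrite flatten_map1 map_nth_iota0 // take_size.
rewrite {1}FsE.
have := perm_flatten_map (fun i => [:: nth fset0 Fs i])
  (fun i => gcaps (facets Fs i)) (iota 0 (size Fs)).
rewrite perm_sym => /perm_trans; apply.
apply: eq_perm_flatten => i; rewrite mem_iota add0n => ltiF.
exact/perm_gcaps/PF.
Qed.
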